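(* Let $\Bbbk$ be an infinite field, let $m\ge1$ and $n>k\ge1$ be integers, and let $\mathfrak{F}=\{V_1,\dots,V_m;W_1,\dots,W_m\}$ be a family of subspaces of $C$ with $\dim V_i=k$, $\operatorname{codim}W_i=k$ for all $i$, such that the algebra $R_{\mathfrak{F}}$ is smooth (i.e. has finite global dimension). Then the triangulated category $\operatorname{perf}R_{\mathfrak{F}}$ does not have exceptional objects.
   Context: $Q_{n,m}$ is the quiver with two vertices $\mathbf{1},\mathbf{2}$, with $n$ arrows $c_1,\dots,c_n$ from $\mathbf{1}$ to $\mathbf{2}$ and $m$ arrows $b_1,\dots,b_m$ from $\mathbf{2}$ to $\mathbf{1}$. Its path algebra $\Bbbk Q_{n,m}$ is generated by idempotents $e_1,e_2$ and the arrows, with $e_{t(a)}a=ae_{s(a)}=a$ (paths are composed right to left). $C$ and $B$ are the vector spaces spanned by $c_1,\dots,c_n$ and by $b_1,\dots,b_m$. $R_{\mathfrak{F}}=\Bbbk Q_{n,m}/I_{\mathfrak{F}}$, where $I_{\mathfrak{F}}$ is the two-sided ideal generated by: (1) $bcb'=0$ for all $c\in C$, $b,b'\in B$; (2) $wb_i=0$ for all $w\in W_i$, $i=1,\dots,m$; (3) $b_iv=0$ for all $v\in V_i$, $i=1,\dots,m$. $\operatorname{perf}R_{\mathfrak{F}}$ is the triangulated category of perfect complexes of right $R_{\mathfrak{F}}$-modules. An object $E$ of a $\Bbbk$-linear triangulated category is exceptional if $\operatorname{Hom}(E,E)\cong\Bbbk$ and $\operatorname{Hom}(E,E[p])=0$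 for all $p\ne0$. *)

(* Defs.v *)
From HB Require Import structures.
From mathcomp Require Import all_boot all_order all_algebra.
From mathcomp Require Import finmap monalg.
From mathcomp Require Import boolp classical_sets cardinality.

Set Implicit Arguments.
Unset Strict Implicit.
Unset Printing Implicit Defensive.

Import Order.TTheory GRing.Theory Num.Theory Quotient.

Local Open Scope ring_scope.

Section QuotientModule.
Variables (K : pzRingType) (A : lmodType K) (I : submodClosed A).

Definition submod_pred : {pred A} := I.

Lemma submod_pred_zmod_closed : zmod_closed submod_pred.
Proof.
split=> [|x y Ix Iy]; rewrite /submod_pred ?rpred0 //.
by rewrite -scaleN1r rpredD ?rpredZ.
Qed.

HB.instance Definition _ :=
  GRing.isZmodClosed.Build A submod_pred submod_pred_zmod_closed.

Definition quot_mod : Type := {quot submod_pred}.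

HB.instance Definition _ := GRing.Zmodule.on quot_mod.

Definition quot_class (x : A) : quot_mod := \pi_({quot submod_pred})%qT x.

Lemma quot_classP x y : quot_class x = quot_class y <-> x - y \in I.
Proof.
by rewrite -[_ \in I]/(x - y \in submod_pred) idealrBE; split=> [/eqP|/eqP].
Qed.

Lemma quot_class_surj (u : quot_mod) : exists x, quot_class x = u.
Proof.
by exists (repr (u : {quot submod_pred})); rewrite /quot_class reprK.
Qed.

Lemma quot_class_add : {morph quot_class : x y / x + y}.
Proof. by move=> x y; rewrite /quot_class raddfD. Qed.

Definition quot_scale (a : K) (u : quot_mod) : quot_mod :=
  quot_class (a *: repr (u : {quot submod_pred})).

Lemma quot_scaleE a x : quot_scale a (quot_class x) = quot_class (a *: x).
Proof.
apply/quot_classP; rewrite -scalerBr rpredZ //.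
by apply/quot_classP; rewrite /quot_class reprK.
Qed.

Lemma quot_scaleA a b u : quot_scale a (quot_scale b u) = quot_scale (a * b) u.
Proof. by have [x <-] := quot_class_surj u; rewrite !quot_scaleE scalerA. Qed.

Lemma quot_scale1 : left_id 1 quot_scale.
Proof.
by move=> u; have [x <-] := quot_class_surj u; rewrite quot_scaleE scale1r.
Qed.

Lemma quot_scaleDr : right_distributive quot_scale +%R.
Proof.
move=> a u v; have [x <-] := quot_class_surj u.
have [y <-] := quot_class_surj v.
by rewrite -quot_class_add !quot_scaleE -quot_class_add scalerDr.
Qed.

Lemma quot_scaleDl u : {morph quot_scale^~ u : a b / a + b}.
Proof.
move=> a b; have [x <-] := quot_class_surj u.
by rewrite !quot_scaleE -quot_class_add scalerDl.
Qed.

HB.instance Definition _ := GRing.Zmodule_isLmodule.Build K quot_mod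
  quot_scaleA quot_scale1 quot_scaleDr quot_scaleDl.

Lemma quot_class_linear : linear quot_class.
Proof. by move=> a x y; rewrite quot_class_add -quot_scaleE. Qed.

HB.instance Definition _ :=
  GRing.isLinear.Build K A quot_mod _ quot_class quot_class_linear.

End QuotientModule.

Record two_sided_ideal (A : nzRingType) (J : A -> Prop) : Prop := {
  tsi0 : J 0;
  tsiD : forall x y, J x -> J y -> J (x + y);
  tsiMl : forall a x, J x -> J (a * x);
  tsiMr : forall a x, J x -> J (x * a) }.

Definition generated_ideal (A : nzRingType) (S : A -> Prop) (x : A) : Prop :=
  forall J : A -> Prop,
    two_sided_ideal J -> (forall s, S s -> J s) -> J x.

Lemma generated_ideal_two_sided (A : nzRingType) (S : A -> Prop) :
  two_sided_ideal (generated_ideal S).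
Proof.
split=> [J HJ _|x y Hx Hy J HJ HS|a x Hx J HJ HS|a x Hx J HJ HS].
- exact: tsi0.
- by apply: tsiD; [exact: HJ|exact: Hx|exact: Hy].
- by apply: tsiMl => //; exact: Hx.
- by apply: tsiMr => //; exact: Hx.
Qed.

Lemma generated_ideal_incl (A : nzRingType) (S : A -> Prop) s :
  S s -> generated_ideal S s.
Proof. by move=> Ss J _; apply. Qed.

(* Properness is part of the data because MathComp algebras are nontrivial. *)
Record proper_tsi (A : nzRingType) := ProperTSI {
  tsi_pred :> A -> Prop;
  tsi_ideal : two_sided_ideal tsi_pred;
  tsi_proper : ~ tsi_pred 1 }.

Section QuotientAlgebra.
Variables (K : pzRingType) (A : algType K) (J : proper_tsi A).

Definition tsi_mem : {pred A} := fun x => `[< J x >].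

Lemma tsi_memP x : reflect (J x) (x \in tsi_mem).
Proof. exact: asboolP. Qed.

Lemma tsi_submod_closed : submod_closed tsi_mem.
Proof.
have HJ := tsi_ideal J; split=> [|a x y /tsi_memP Jx /tsi_memP Jy].
  by apply/tsi_memP; exact: tsi0.
apply/tsi_memP; apply: tsiD => //.
by rewrite -[x]mul1r scalerAl; exact: tsiMl.
Qed.

HB.instance Definition _ :=
  GRing.isSubmodClosed.Build K A tsi_mem tsi_submod_closed.

Definition quot_alg : Type := quot_mod tsi_mem.

HB.instance Definition _ := GRing.Lmodule.on quot_alg.

Definition alg_class (x : A) : quot_alg := quot_class tsi_mem x.

Lemma alg_classP x y : alg_class x = alg_class y <-> J (x - y).
Proof. by rewrite quot_classP; split=> /tsi_memP. Qed.

Lemma alg_class_surj (u : quot_alg) : exists x, alg_class x = u.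
Proof. exact: quot_class_surj. Qed.

Lemma alg_class_linear : linear alg_class.
Proof. exact: quot_class_linear. Qed.

HB.instance Definition _ :=
  GRing.isLinear.Build K A quot_alg _ alg_class alg_class_linear.

Definition quot_mul (u v : quot_alg) : quot_alg :=
  alg_class (repr (u : {quot (submod_pred tsi_mem)})
             * repr (v : {quot (submod_pred tsi_mem)})).

Lemma quot_mulE x y :
  quot_mul (alg_class x) (alg_class y) = alg_class (x * y).
Proof.
have HJ := tsi_ideal J.
have Jrepr z : J (repr (alg_class z : {quot (submod_pred tsi_mem)}) - z).
  by apply/alg_classP; rewrite /alg_class /quot_class reprK.
apply/alg_classP; set x' := repr _; set y' := repr _.
have -> : x' * y' - x * y = (x' - x) * y' + x * (y' - y).
  by rewrite mulrBl mulrBr addrA subrK.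
by apply: tsiD => //; [apply: tsiMr|apply: tsiMl] => //; exact: Jrepr.
Qed.

Lemma quot_mulA : associative quot_mul.
Proof.
move=> u v w; have [x <-] := alg_class_surj u.
have [y <-] := alg_class_surj v; have [z <-] := alg_class_surj w.
by rewrite !quot_mulE mulrA.
Qed.

Lemma quot_mul1 : left_id (alg_class 1) quot_mul.
Proof.
by move=> u; have [x <-] := alg_class_surj u; rewrite quot_mulE mul1r.
Qed.

Lemma quot_mulr1 : right_id (alg_class 1) quot_mul.
Proof.
by move=> u; have [x <-] := alg_class_surj u; rewrite quot_mulE mulr1.
Qed.

Lemma quot_mulDl : left_distributive quot_mul +%R.
Proof.
move=> u v w; have [x <-] := alg_class_surj u.
have [y <-] := alg_class_surj v; have [z <-] := alg_class_surj w.
by rewrite -linearD !quot_mulE mulrDl linearD.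
Qed.

Lemma quot_mulDr : right_distributive quot_mul +%R.
Proof.
move=> u v w; have [x <-] := alg_class_surj u.
have [y <-] := alg_class_surj v; have [z <-] := alg_class_surj w.
by rewrite -linearD !quot_mulE mulrDr linearD.
Qed.

Lemma quot_1_neq0 : alg_class 1 != 0.
Proof.
apply/eqP; rewrite -[0](linear0 alg_class) => /alg_classP.
by rewrite subr0; exact: tsi_proper.
Qed.

HB.instance Definition _ := GRing.Zmodule_isNzRing.Build quot_alg
  quot_mulA quot_mul1 quot_mulr1 quot_mulDl quot_mulDr quot_1_neq0.

Lemma alg_classM : {morph alg_class : x y / x * y}.
Proof. by move=> x y; exact/esym/quot_mulE. Qed.

Lemma alg_classZ a : {morph alg_class : x / a *: x}.
Proof. by move=> x; rewrite linearZ. Qed.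

Lemma quot_scaleAl (a : K) (u v : quot_alg) : a *: (u * v) = (a *: u) * v.
Proof.
have [x <-] := alg_class_surj u; have [y <-] := alg_class_surj v.
by rewrite -!(alg_classZ, alg_classM) scalerAl.
Qed.

HB.instance Definition _ :=
  GRing.Lmodule_isLalgebra.Build K quot_alg quot_scaleAl.

Lemma quot_scaleAr (a : K) (u v : quot_alg) : a *: (u * v) = u * (a *: v).
Proof.
have [x <-] := alg_class_surj u; have [y <-] := alg_class_surj v.
by rewrite -!(alg_classZ, alg_classM) scalerAr.
Qed.

HB.instance Definition _ :=
  GRing.Lalgebra_isAlgebra.Build K quot_alg quot_scaleAr.

End QuotientAlgebra.

(* The vertex [vertex0] only records that there is a vertex, so that the path
   algebra is nontrivial. *)
Record quiver := Quiver {
  vertex : finType;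
  arrow : finType;
  src : arrow -> vertex;
  tgt : arrow -> vertex;
  vertex0 : vertex }.

Section Paths.
Variable Q : quiver.

(* Words are read from right to left: [walk v (a_1 :: ... :: a_l)] says that
   a_1 ... a_l is a path ending at v, with src a_i = tgt a_(i+1). *)
Fixpoint walk (v : vertex Q) (w : seq (arrow Q)) : bool :=
  if w is a :: w' then (tgt a == v) && walk (src a) w' else true.

Definition walk_src (v : vertex Q) (w : seq (arrow Q)) : vertex Q :=
  last v [seq src a | a <- w].

Lemma walk_cat v w1 w2 :
  walk v (w1 ++ w2) = walk v w1 && walk (walk_src v w1) w2.
Proof. by elim: w1 v => //= a w1 IH v; rewrite IH andbA. Qed.

Definition qpath : Type :=
  {p : vertex Q * seq (arrow Q) | walk p.1 p.2}.

HB.instance Definition _ := SubChoice.on qpath.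

Definition ptgt (p : qpath) : vertex Q := (val p).1.
Definition psrc (p : qpath) : vertex Q := walk_src (val p).1 (val p).2.

Definition path_nil (v : vertex Q) : qpath := exist _ (v, [::]) isT.

Lemma walk_arrow (a : arrow Q) : walk (tgt a) [:: a].
Proof. by rewrite /= eqxx. Qed.

Definition path_arrow (a : arrow Q) : qpath :=
  exist _ (tgt a, [:: a]) (walk_arrow a).

(* The composite pq, first q and then p, when q ends where p starts. *)
Definition path_comp (p q : qpath) : option qpath :=
  if psrc p == ptgt q then insub (ptgt p, (val p).2 ++ (val q).2)
  else None.

Lemma path_compP (p q : qpath) :
  if psrc p == ptgt q then
    exists2 r, path_comp p q = Some r
             & val r = (ptgt p, (val p).2 ++ (val q).2)
  else path_comp p q = None.
Proof.
rewrite /path_comp; case: eqP => // Epq.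
case: insubP => [r _ Er|]; first by exists r.
rewrite /= walk_cat (valP p) /= -/(psrc p) Epq.
by rewrite /ptgt (valP q).
Qed.

Lemma path_comp_ends (p q r : qpath) : path_comp p q = Some r ->
  [/\ psrc p = ptgt q, ptgt r = ptgt p, psrc r = psrc q
    & (val r).2 = (val p).2 ++ (val q).2].
Proof.
have := path_compP p q; case: eqP => [Epq [s -> Es] [<-]|_ -> //].
split=> //; rewrite ?/ptgt ?Es //.
rewrite /psrc Es /= /walk_src map_cat last_cat.
by rewrite -/(walk_src (ptgt p) (val p).2) -/(psrc p) Epq.
Qed.

Lemma path_comp_None (p q : qpath) : path_comp p q = None -> psrc p <> ptgt q.
Proof. by have := path_compP p q; case: eqP => // _ [r ->]. Qed.

Lemma qpath_ext (p q : qpath) :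
  ptgt p = ptgt q -> (val p).2 = (val q).2 -> p = q.
Proof.
move=> E1 E2; apply: val_inj; move: E1 E2; rewrite /ptgt.
by case: (val p) (val q) => [v w] [v' w'] /= -> ->.
Qed.

Lemma path_compA (p q r : qpath) :
  obind (path_comp p) (path_comp q r)
    = obind (fun s => path_comp s r) (path_comp p q).
Proof.
case Eqr: (path_comp q r) => [s|]; case Epq: (path_comp p q) => [t|] //=.
- have [H1 H2 H3 H4] := path_comp_ends Eqr.
  have [I1 I2 I3 I4] := path_comp_ends Epq.
  case E1: (path_comp p s) => [u|]; last first.
    by case: (path_comp_None E1); rewrite H2.
  case E2: (path_comp t r) => [v|]; last first.
    by case: (path_comp_None E2); rewrite I3.
  have [_ J2 _ J4] := path_comp_ends E1; have [_ K2 _ K4] := path_comp_ends E2.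
  by congr Some; apply: qpath_ext; rewrite ?J2 ?K2 ?J4 ?K4 ?H4 ?I4 ?catA.
- have [H1 H2 H3 H4] := path_comp_ends Eqr.
  case E1: (path_comp p s) => [u|] //; have [J1 _ _ _] := path_comp_ends E1.
  by case: (path_comp_None Epq); rewrite J1.
- have [I1 I2 I3 I4] := path_comp_ends Epq.
  case E2: (path_comp t r) => [v|] //; have [K1 _ _ _] := path_comp_ends E2.
  by case: (path_comp_None Eqr); rewrite -K1.
Qed.

Lemma path_comp_nill v (p : qpath) :
  path_comp (path_nil v) p = if v == ptgt p then Some p else None.
Proof.
have := path_compP (path_nil v) p; rewrite [psrc _]/=.
case: eqP => [E [r -> Er]|//]; congr Some; apply: qpath_ext.
  by rewrite {1}/ptgt Er.
by rewrite Er.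
Qed.

Lemma path_comp_nilr v (p : qpath) :
  path_comp p (path_nil v) = if psrc p == v then Some p else None.
Proof.
have := path_compP p (path_nil v); rewrite [ptgt (path_nil v)]/=.
case: eqP => [E [r -> Er]|//]; congr Some; apply: qpath_ext.
  by rewrite {1}/ptgt Er.
by rewrite Er cats0.
Qed.

Lemma path_comp_nil_inv v (p q : qpath) :
  path_comp p q = Some (path_nil v) -> p = path_nil v /\ q = path_nil v.
Proof.
move=> E; have [H1 H2 H3 /= H4] := path_comp_ends E.
have Ep : (val p).2 = [::] by case: (val p).2 H4.
have Eq : (val q).2 = [::] by case: (val q).2 H4 => //; rewrite Ep.
have E1 : p = path_nil v by apply: qpath_ext.
by split=> //; apply: qpath_ext => //; rewrite -H1 E1.
Qed.

End Paths.

Definition path_algebra (K : fieldType) (Q : quiver) : Type :=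
  {malg K[qpath Q]}.

HB.instance Definition _ (K : fieldType) (Q : quiver) :=
  GRing.Lmodule.on (path_algebra K Q).

(* The locked definitions prevent costly unfoldings during unification. *)
HB.lock Definition pa_path (K : fieldType) (Q : quiver) (p : qpath Q) :
  path_algebra K Q := << p >>.

Definition path_mul (K : fieldType) (Q : quiver) (p q : qpath Q) :
    path_algebra K Q :=
  if path_comp p q is Some r then pa_path K r else 0.

HB.lock Definition pa_mul (K : fieldType) (Q : quiver)
    (x y : path_algebra K Q) : path_algebra K Q :=
  \sum_(p <- msupp x) \sum_(q <- msupp y) (x@_p * y@_q) *: path_mul K p q.

Section PathAlgebra.
Variables (K : fieldType) (Q : quiver).

Local Notation path_algebra := (path_algebra K Q).
Local Notation pa_path := (@pa_path K Q).
Local Notation path_mul := (@path_mul K Q).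
Local Notation pa_mul := (@pa_mul K Q).

Implicit Types (x y z : path_algebra) (p q r : qpath Q).

Definition pa_one : path_algebra := \sum_(v : vertex Q) pa_path (path_nil v).

Lemma mcoeff_lin a x y p : (a *: x + y)@_p = a * x@_p + y@_p.
Proof.
rewrite [LHS](mcoeffD p (a *: x : {malg K[qpath Q]}) y); congr (_ + _).
exact: (mcoeffZ a (x : {malg K[qpath Q]}) p).
Qed.

Lemma mcoeff_path p q : (pa_path p)@_q = (p == q)%:R.
Proof. by rewrite pa_path.unlock mcoeffU. Qed.

Lemma pa_mulw (d1 d2 : {fset qpath Q}) x y :
  (msupp x `<=` d1)%fset -> (msupp y `<=` d2)%fset ->
  pa_mul x y =
    \sum_(p <- d1) \sum_(q <- d2) (x@_p * y@_q) *: path_mul p q.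
Proof.
move=> le1 le2; rewrite pa_mul.unlock (big_fset_incl _ le1) /=.
  apply: eq_bigr => p _; apply: big_fset_incl => // q _ /mcoeff_outdom ->.
  by rewrite mulr0 scale0r.
move=> p _ /mcoeff_outdom xp.
by rewrite big1 // => q _; rewrite xp mul0r scale0r.
Qed.

Lemma pa_mulDl : left_distributive pa_mul +%R.
Proof.
move=> x y z; set d := (msupp x `|` msupp y)%fset.
rewrite (@pa_mulw d (msupp z)) ?msuppD_le ?fsubset_refl //.
rewrite (@pa_mulw d (msupp z) x) ?fsubsetUl ?fsubset_refl //.
rewrite (@pa_mulw d (msupp z) y) ?fsubsetUr ?fsubset_refl //.
rewrite -big_split /=; apply: eq_bigr => p _.
rewrite -big_split /=; apply: eq_bigr => q _.
by rewrite mcoeffD mulrDl scalerDl.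
Qed.

Lemma pa_mulDr : right_distributive pa_mul +%R.
Proof.
move=> z x y; set d := (msupp x `|` msupp y)%fset.
rewrite (@pa_mulw (msupp z) d) ?msuppD_le ?fsubset_refl //.
rewrite (@pa_mulw (msupp z) d z x) ?fsubsetUl ?fsubset_refl //.
rewrite (@pa_mulw (msupp z) d z y) ?fsubsetUr ?fsubset_refl //.
rewrite -big_split /=; apply: eq_bigr => p _.
rewrite -big_split /=; apply: eq_bigr => q _.
by rewrite mcoeffD mulrDr scalerDl.
Qed.

Lemma pa_mulZl a x y : pa_mul (a *: x) y = a *: pa_mul x y.
Proof.
rewrite (@pa_mulw (msupp x) (msupp y)) ?msuppZ_le ?fsubset_refl //.
rewrite pa_mul.unlock scaler_sumr; apply: eq_bigr => p _.
rewrite scaler_sumr; apply: eq_bigr => q _.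
by rewrite mcoeffZ -mulrA scalerA.
Qed.

Lemma pa_mulZr a x y : pa_mul x (a *: y) = a *: pa_mul x y.
Proof.
rewrite (@pa_mulw (msupp x) (msupp y)) ?msuppZ_le ?fsubset_refl //.
rewrite pa_mul.unlock scaler_sumr; apply: eq_bigr => p _.
rewrite scaler_sumr; apply: eq_bigr => q _.
by rewrite mcoeffZ mulrCA scalerA.
Qed.

Lemma pa_mul0l : left_zero 0 pa_mul.
Proof.
by move=> x; rewrite -[0](scale0r (0 : path_algebra)) pa_mulZl !scale0r.
Qed.

Lemma pa_mul0r : right_zero 0 pa_mul.
Proof.
by move=> x; rewrite -[0](scale0r (0 : path_algebra)) pa_mulZr !scale0r.
Qed.

Lemma pa_mulUU p q : pa_mul (pa_path p) (pa_path q) = path_mul p q.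
Proof.
rewrite (@pa_mulw [fset p]%fset [fset q]%fset) ?pa_path.unlock ?msuppU_le //.
by rewrite !big_seq_fset1 !mcoeffUU mulr1 scale1r.
Qed.

Lemma malgU_scale (a : K) p : << a *g p >> = a *: pa_path p.
Proof.
apply/malgP => q; rewrite mcoeffU.
rewrite [RHS](mcoeffZ a (pa_path p : {malg K[qpath Q]}) q).
by rewrite mcoeff_path mulr_natr.
Qed.

Lemma pa_ind (P : path_algebra -> Prop) :
  (forall a x y, P x -> P y -> P (a *: x + y)) -> P 0 ->
  (forall p, P (pa_path p)) -> forall x, P x.
Proof.
move=> Plin P0 PU x; rewrite [x]monalgE.
elim/big_rec: _ => // p y _ Py.
by rewrite malgU_scale; exact: Plin.
Qed.

Lemma path_mulA p q r :
  pa_mul (pa_path p) (path_mul q r) = pa_mul (path_mul p q) (pa_path r).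
Proof.
have := path_compA p q r; rewrite /path_mul.
case: (path_comp q r) (path_comp p q) => [s|] [t|] /= E;
  rewrite ?pa_mul0l ?pa_mul0r ?pa_mulUU /path_mul ?E //.
by rewrite -E.
Qed.

Lemma pa_mulA : associative pa_mul.
Proof.
move=> x y z.
elim/pa_ind: x => [a x x' Hx Hx'||p]; first by
  rewrite !(pa_mulDl, pa_mulZl) Hx Hx'.
  by rewrite !pa_mul0l.
elim/pa_ind: y => [a x x' Hx Hx'||q]; first by
  rewrite !(pa_mulDl, pa_mulZl, pa_mulDr, pa_mulZr) Hx Hx'.
  by rewrite !(pa_mul0l, pa_mul0r).
elim/pa_ind: z => [a x x' Hx Hx'||r]; first by
  rewrite !(pa_mulDr, pa_mulZr) Hx Hx'.
  by rewrite !pa_mul0r.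
by rewrite !pa_mulUU path_mulA.
Qed.

Lemma pa_mulsuml (I : Type) (s : seq I) (F : I -> path_algebra) x :
  pa_mul (\sum_(i <- s) F i) x = \sum_(i <- s) pa_mul (F i) x.
Proof.
exact: (big_morph (pa_mul^~ x) (fun _ _ => pa_mulDl _ _ _) (pa_mul0l x)).
Qed.

Lemma pa_mulsumr (I : Type) (s : seq I) (F : I -> path_algebra) x :
  pa_mul x (\sum_(i <- s) F i) = \sum_(i <- s) pa_mul x (F i).
Proof.
exact: (big_morph (pa_mul x) (fun _ _ => pa_mulDr _ _ _) (pa_mul0r x)).
Qed.

Lemma path_mul_nill v p :
  path_mul (path_nil v) p = if v == ptgt p then pa_path p else 0.
Proof.
by rewrite /path_mul path_comp_nill; case: ifP.
Qed.

Lemma path_mul_nilr v p :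
  path_mul p (path_nil v) = if psrc p == v then pa_path p else 0.
Proof.
by rewrite /path_mul path_comp_nilr; case: ifP.
Qed.

Lemma pa_mul1 : left_id pa_one pa_mul.
Proof.
move=> x; elim/pa_ind: x => [a x x' Hx Hx'||p].
- by rewrite pa_mulDr pa_mulZr Hx Hx'.
- by rewrite pa_mul0r.
rewrite pa_mulsuml (bigD1 (ptgt p)) //= big1 => [|v /negPf Ev].
  by rewrite pa_mulUU path_mul_nill eqxx addr0.
by rewrite pa_mulUU path_mul_nill Ev.
Qed.

Lemma pa_mulr1 : right_id pa_one pa_mul.
Proof.
move=> x; elim/pa_ind: x => [a x x' Hx Hx'||p].
- by rewrite pa_mulDl pa_mulZl Hx Hx'.
- by rewrite pa_mul0l.
rewrite pa_mulsumr (bigD1 (psrc p)) //= big1 => [|v].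
  by rewrite pa_mulUU path_mul_nilr eqxx addr0.
by rewrite pa_mulUU path_mul_nilr eq_sym => /negPf ->.
Qed.

Lemma pa_one_coef v : pa_one@_(path_nil v) = 1.
Proof.
rewrite /pa_one raddf_sum (bigD1 v) //= big1 => [|w /negPf Ew].
  by rewrite mcoeff_path eqxx addr0.
rewrite mcoeff_path; case: eqP => // /(congr1 (@ptgt Q)) E.
by rewrite -[w]/(ptgt (path_nil w)) E eqxx in Ew.
Qed.

Lemma pa_1_neq0 : pa_one != 0.
Proof.
apply/eqP => /(congr1 (mcoeff (path_nil (vertex0 Q)))).
by rewrite pa_one_coef mcoeff0 => /eqP; rewrite oner_eq0.
Qed.

HB.instance Definition _ := GRing.Zmodule_isNzRing.Build path_algebra
  pa_mulA pa_mul1 pa_mulr1 pa_mulDl pa_mulDr pa_1_neq0.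

Lemma pa_scaleAl a x y : a *: (x * y) = (a *: x) * y.
Proof. exact/esym/pa_mulZl. Qed.

HB.instance Definition _ :=
  GRing.Lmodule_isLalgebra.Build K path_algebra pa_scaleAl.

Lemma pa_scaleAr a x y : a *: (x * y) = x * (a *: y).
Proof. exact/esym/pa_mulZr. Qed.

HB.instance Definition _ :=
  GRing.Lalgebra_isAlgebra.Build K path_algebra pa_scaleAr.

Definition pa_vertex (v : vertex Q) : path_algebra := pa_path (path_nil v).
Definition pa_arrow (a : arrow Q) : path_algebra := pa_path (path_arrow a).

Lemma pa_coef_nilM v x y :
  (x * y)@_(path_nil v) = x@_(path_nil v) * y@_(path_nil v).
Proof.
elim/pa_ind: x => [a x x' Hx Hx'||p].
- by rewrite mulrDl -scalerAl !mcoeff_lin Hx Hx' mulrDl mulrA.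
- by rewrite mul0r !mcoeff0 mul0r.
elim/pa_ind: y => [a y y' Hy Hy'||q].
- by rewrite mulrDr -scalerAr !mcoeff_lin Hy Hy' mulrDr mulrCA.
- by rewrite mulr0 !mcoeff0 mulr0.
rewrite [_ * _]pa_mulUU /path_mul.
case E: (path_comp p q) => [r|]; rewrite !mcoeff_path ?mcoeff0; last first.
  case: eqP E => [->|_]; case: eqP => [->|_]; rewrite ?mulr0 ?mul0r //.
  by rewrite path_comp_nill eqxx.
case: eqP => [Er|Nr]; first rewrite Er in E.
  by have [-> ->] := path_comp_nil_inv E; rewrite eqxx mulr1.
case: eqP E => [->|_]; case: eqP => [->|_]; rewrite ?mulr0 ?mul0r //.
by rewrite path_comp_nill eqxx => -[/esym].
Qed.

Lemma pa_arrow_coef v a : (pa_arrow a)@_(path_nil v) = 0.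
Proof. by rewrite mcoeff_path; case: eqP => // /(congr1 val). Qed.

End PathAlgebra.

(* The vertices 1 and 2 are [false] and [true]; [inl j] is c_j : 1 -> 2 and
   [inr i] is b_i : 2 -> 1. *)
Definition quiver_nm (n m : nat) : quiver :=
  @Quiver bool ('I_n + 'I_m)%type
    (fun a => if a is inl _ then false else true)
    (fun a => if a is inl _ then true else false) false.

Section AlgebraRF.
Variables (K : fieldType) (n m : nat) (V W : 'I_m -> {vspace 'rV[K]_n}).

Local Notation KQ := (path_algebra K (quiver_nm n m)).

Definition arrow_b (i : 'I_m) : KQ :=
  pa_arrow K (inr i : arrow (quiver_nm n m)).
Definition arrow_c (j : 'I_n) : KQ :=
  pa_arrow K (inl j : arrow (quiver_nm n m)).

(* The spaces C and B are the coordinate spaces 'rV[K]_n and 'rV[K]_m. *)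
Definition Cvec (c : 'rV[K]_n) : KQ := \sum_j c 0 j *: arrow_c j.
Definition Bvec (b : 'rV[K]_m) : KQ := \sum_i b 0 i *: arrow_b i.

Inductive RF_relation : KQ -> Prop :=
| RF_bcb b c b' : RF_relation (Bvec b * Cvec c * Bvec b')
| RF_wb i w : w \in W i -> RF_relation (Cvec w * arrow_b i)
| RF_bv i v : v \in V i -> RF_relation (arrow_b i * Cvec v).

Lemma RF_relation_coef s :
  RF_relation s -> s@_(path_nil (vertex0 (quiver_nm n m))) = 0.
Proof.
have Cv c v : (Cvec c)@_(path_nil v) = 0.
  rewrite /Cvec; elim/big_rec: _ => [|j x _ Hx]; first exact: mcoeff0.
  by rewrite mcoeff_lin Hx pa_arrow_coef mulr0 addr0.
case=> [b c b'|i w _|i v _]; rewrite !pa_coef_nilM Cv ?(mulr0, mul0r) //.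
Qed.

Lemma RF_ideal_proper : ~ generated_ideal RF_relation 1.
Proof.
pose v0 : vertex (quiver_nm n m) := vertex0 _.
move/(_ (fun x => x@_(path_nil v0) = 0)) => /(_ _ RF_relation_coef) H.
have /eqP : (1 : KQ)@_(path_nil v0) = 0.
  apply: H; split=> [|x y Hx Hy|a x Hx|a x Hx].
  - exact: mcoeff0.
  - by rewrite -[x]scale1r mcoeff_lin Hx Hy mulr0 addr0.
  - by rewrite pa_coef_nilM Hx mulr0.
  - by rewrite pa_coef_nilM Hx mul0r.
by rewrite pa_one_coef oner_eq0.
Qed.

Definition RF_ideal : proper_tsi KQ :=
  ProperTSI (generated_ideal_two_sided RF_relation) RF_ideal_proper.

Definition RF : Type := quot_alg RF_ideal.

HB.instance Definition _ := GRing.Algebra.on RF.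

End AlgebraRF.

(* Right R-modules are left modules over the opposite ring R^c. *)
Notation rmodType R := (lmodType R^c).

Section Modules.
Variable R : nzRingType.

Definition is_zero_mod (M : rmodType R) : Prop := forall x : M, x = 0.

Definition projective (P : rmodType R) : Prop :=
  forall (M N : rmodType R) (g : {linear M -> N}) (f : {linear P -> N}),
    (forall y, exists x, g x = y) ->
    exists h : {linear P -> M}, forall x, g (h x) = f x.

Definition finitely_generated (M : rmodType R) : Prop :=
  exists (l : nat) (g : 'I_l -> M),
    forall x, exists r : 'I_l -> R^c, x = \sum_i r i *: g i.

(* Cochain complexes indexed by the integers. The differential is a family
   over all pairs (i, j), zero unless j = i + 1; in this way the equations
   below need no transport along equalities between indices. *)
Record complex := Complex {
  cobj :> int -> rmodType R;
  cdiff : forall i j, {linear cobj i -> cobj j};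
  cdiff_shape : forall i j, j != i + 1 -> forall x, cdiff i j x = 0;
  cdiffK : forall i j l x, cdiff j l (cdiff i j x) = 0 }.

Definition projective_resolution (M : rmodType R) (P : complex)
    (eps : {linear P 0 -> M}) : Prop :=
  [/\ forall i, projective (P i),
      forall i, 0 < i -> is_zero_mod (P i),
      forall i, i < 0 -> forall x : P i, cdiff P i (i + 1) x = 0 ->
        exists y, cdiff P (i - 1) i y = x,
      forall x, eps x = 0 <-> exists y, cdiff P (- 1) 0 y = x
    & forall z, exists x, eps x = z].

Definition proj_dim_le (M : rmodType R) (d : nat) : Prop :=
  exists (P : complex) (eps : {linear P 0 -> M}),
    projective_resolution eps /\ forall i, i < - d%:Z -> is_zero_mod (P i).

Definition finite_global_dimension : Prop :=
  exists d : nat, forall M : rmodType R, proj_dim_le M d.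

End Modules.

Section HomotopyCategory.
Variables (K : fieldType) (R : algType K).

(* K acts on a right R-module M through K -> R. *)
Definition kscale (M : rmodType R) (a : K) (x : M) : M :=
  ((a%:A : R) : R^c) *: x.

Lemma kscale_linear (M : rmodType R) a : linear (@kscale M a).
Proof.
move=> r x y; rewrite /kscale scalerDr !scalerA; congr (_ *: _ + _).
by rewrite /GRing.mul /= -scalerAl -scalerAr mul1r mulr1.
Qed.

HB.instance Definition _ (M : rmodType R) a :=
  GRing.isLinear.Build R^c M M _ (@kscale M a) (@kscale_linear M a).

Lemma kscaleA (M : rmodType R) a b (x : M) :
  kscale a (kscale b x) = kscale (a * b) x.
Proof.
rewrite /kscale scalerA; congr (_ *: _).
by rewrite /GRing.mul /= -scalerAl mul1r scalerA mulrC.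
Qed.

Lemma kscale1 (M : rmodType R) (x : M) : kscale 1 x = x.
Proof. by rewrite /kscale (scale1r (1 : R)) scale1r. Qed.

Lemma kscaleDl (M : rmodType R) a b (x : M) :
  kscale (a + b) x = kscale a x + kscale b x.
Proof. by rewrite /kscale (scalerDl (1 : R)) scalerDl. Qed.

Section ChainMaps.
Variables E F : complex R.

Record chain_map := ChainMap {
  cm_fun :> forall i, E i -> F i;
  cm_linear : forall i, linear (@cm_fun i);
  cm_comm : forall i j (x : E i),
    cdiff F i j (cm_fun x) = cm_fun (cdiff E i j x) }.

Arguments cm_fun _ i x : clear implicits.

HB.instance Definition _ (f : chain_map) i :=
  GRing.isLinear.Build R^c (E i) (F i) _ (f i) (@cm_linear f i).

HB.instance Definition _ := gen_eqMixin chain_map.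
HB.instance Definition _ := gen_choiceMixin chain_map.

Lemma chain_map_ext (f g : chain_map) : (forall i x, f i x = g i x) -> f = g.
Proof.
case: f g => [f Hf Cf] [g Hg Cg] /= E1.
have {}E1 : f = g.
  by apply: functional_extensionality_dep => i; apply/funext => x.
case: _ / E1 in Hg Cg *.
by rewrite (Prop_irrelevance Hf Hg) (Prop_irrelevance Cf Cg).
Qed.

Lemma cm0_linear i : linear (fun _ : E i => 0 : F i).
Proof. by move=> r x y; rewrite scaler0 addr0. Qed.

Lemma cm0_comm i j (_ : E i) : cdiff F i j 0 = 0.
Proof. exact: linear0. Qed.

Definition cm0 : chain_map :=
  @ChainMap (fun i _ => 0) cm0_linear cm0_comm.

Lemma cm_opp_linear (f : chain_map) i : linear (fun x => - f i x).
Proof. by move=> r x y; rewrite linearP opprD scalerN. Qed.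

Lemma cm_opp_comm (f : chain_map) i j x :
  cdiff F i j (- f i x) = - f j (cdiff E i j x).
Proof. by rewrite linearN cm_comm. Qed.

Definition cm_opp (f : chain_map) : chain_map :=
  ChainMap (cm_opp_linear f) (cm_opp_comm f).

Lemma cm_add_linear (f g : chain_map) i : linear (fun x => f i x + g i x).
Proof. by move=> r x y; rewrite !linearP scalerDr addrACA. Qed.

Lemma cm_add_comm (f g : chain_map) i j x :
  cdiff F i j (f i x + g i x) = f j (cdiff E i j x) + g j (cdiff E i j x).
Proof. by rewrite linearD !cm_comm. Qed.

Definition cm_add (f g : chain_map) : chain_map :=
  ChainMap (cm_add_linear f g) (cm_add_comm f g).

Lemma cm_scale_linear a (f : chain_map) i : linear (fun x => kscale a (f i x)).
Proof. by move=> r x y; rewrite !linearP. Qed.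

Lemma cm_scale_comm a (f : chain_map) i j x :
  cdiff F i j (kscale a (f i x)) = kscale a (f j (cdiff E i j x)).
Proof. by rewrite /kscale linearZ -cm_comm. Qed.

Definition cm_scale (a : K) (f : chain_map) : chain_map :=
  ChainMap (cm_scale_linear a f) (cm_scale_comm a f).

Lemma cm_addA : associative cm_add.
Proof. by move=> f g h; apply: chain_map_ext => i x /=; rewrite addrA. Qed.

Lemma cm_addC : commutative cm_add.
Proof. by move=> f g; apply: chain_map_ext => i x /=; rewrite addrC. Qed.

Lemma cm_add0 : left_id cm0 cm_add.
Proof. by move=> f; apply: chain_map_ext => i x /=; rewrite add0r. Qed.

Lemma cm_addN : left_inverse cm0 cm_opp cm_add.
Proof. by move=> f; apply: chain_map_ext => i x /=; rewrite addNr. Qed.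

HB.instance Definition _ :=
  GRing.isZmodule.Build chain_map cm_addA cm_addC cm_add0 cm_addN.

Lemma cm_scaleA a b f : cm_scale a (cm_scale b f) = cm_scale (a * b) f.
Proof. by apply: chain_map_ext => i x /=; rewrite kscaleA. Qed.

Lemma cm_scale1 : left_id 1 cm_scale.
Proof. by move=> f; apply: chain_map_ext => i x /=; rewrite kscale1. Qed.

Lemma cm_scaleDr : right_distributive cm_scale +%R.
Proof. by move=> a f g; apply: chain_map_ext => i x /=; rewrite linearD. Qed.

Lemma cm_scaleDl f : {morph cm_scale^~ f : a b / a + b}.
Proof. by move=> a b; apply: chain_map_ext => i x /=; rewrite kscaleDl. Qed.

HB.instance Definition _ := GRing.Zmodule_isLmodule.Build K chain_map
  cm_scaleA cm_scale1 cm_scaleDr cm_scaleDl.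

(* Of the homotopy h only the components E i -> F (i - 1) are used. *)
Definition null_homotopic (f : chain_map) : Prop :=
  exists h : forall i j, {linear E i -> F j}, forall i x,
    f i x = cdiff F (i - 1) i (h i (i - 1) x)
            + h (i + 1) i (cdiff E i (i + 1) x).

Definition null_pred : {pred chain_map} := fun f => `[< null_homotopic f >].

Lemma null_submod_closed : submod_closed null_pred.
Proof.
split=> [|a f g /asboolP[h Hh] /asboolP[h' Hh']]; apply/asboolP.
  by exists (fun i j => \0) => i x /=; rewrite linear0 addr0.
exists (fun i j => (@kscale _ a \o h i j) \+ h' i j) => i x.
rewrite [LHS]/= Hh Hh' /= !linearD /= addrACA; congr (_ + _ + _).
by rewrite /kscale linearZ.
Qed.

HB.instance Definition _ :=
  GRing.isSubmodClosed.Build K chain_map null_pred null_submod_closed.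

Definition htpy_hom : Type := quot_mod null_pred.

HB.instance Definition _ := GRing.Lmodule.on htpy_hom.

End ChainMaps.

Section Shift.
Variables (E : complex R) (p : int).

Definition shift_diff (i j : int) : {linear E (i + p) -> E (j + p)} :=
  @kscale _ ((- 1) ^+ `|p|%N) \o cdiff E (i + p) (j + p).

Lemma shift_shape i j : j != i + 1 -> forall x, shift_diff i j x = 0.
Proof.
move=> Eij x /=; rewrite cdiff_shape ?linear0 // addrAC.
by apply: contra Eij => /eqP/addIr ->.
Qed.

Lemma shift_diffK i j l x : shift_diff j l (shift_diff i j x) = 0.
Proof. by rewrite /= /kscale linearZ_LR cdiffK !scaler0. Qed.

Definition complex_shift : complex R :=
  @Complex R (fun i => E (i + p)) shift_diff shift_shape shift_diffK.

End Shift.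

(* Objects of perf R, realised as the homotopy category of bounded complexes
   of finitely generated projective right modules. *)
Record perf := Perf {
  perf_complex :> complex R;
  perf_bounded : exists a b : int,
    forall i, (i < a) || (b < i) -> is_zero_mod (perf_complex i);
  perf_proj : forall i, projective (perf_complex i);
  perf_fg : forall i, finitely_generated (perf_complex i) }.

Lemma perf_shift_bounded (E : perf) (p : int) : exists a b : int,
  forall i, (i < a) || (b < i) -> is_zero_mod (complex_shift E p i).
Proof.
have [a [b H]] := perf_bounded E; exists (a - p), (b - p) => i Hi.
by apply: H; rewrite -ltrBrDr -[b < _]ltrBlDr.
Qed.

Definition perf_shift (E : perf) (p : int) : perf :=
  @Perf (complex_shift E p) (perf_shift_bounded E p)
    (fun i => @perf_proj E (i + p)) (fun i => @perf_fg E (i + p)).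

Definition exceptional (E : perf) : Prop :=
  (exists phi : {linear htpy_hom E E -> K^o}, bijective phi) /\
  forall p : int, p != 0 -> forall f : htpy_hom E (perf_shift E p), f = 0.

End HomotopyCategory.

Definition codimv (K : fieldType) (vT : vectType K) (U : {vspace vT}) : nat :=
  (\dim {:vT} - \dim U)%N.

(* Main.v *)
From HB Require Import structures.
Require Import Defs.
From mathcomp Require Import all_boot all_order all_algebra.
From mathcomp Require Import finmap monalg.
From mathcomp Require Import boolp classical_sets cardinality.
From mathcomp Require Import zify ring.

(* The theorem is numerical: an exceptional object E has Euler characteristic
   chi(E, E) = 1, and the Euler form of perf R does not represent 1.

   Homotopy classes of graded endomorphisms of E are the homology of a
   two-periodic complex of finite-dimensional spaces (maps of even degree, maps
   of odd degree). Every finitely generated projective module is a sum of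
   copies of e_1 R and e_2 R, so if x and y are the alternating multiplicities
   of these in E, and l = n - k, comparing dimensions gives
     chi(E, E) = (1 + m l) x^2 + (n + k m l + m) x y + (1 + m k) y^2,
   the coefficients being the dimensions of the spaces e_v R e_w. The underlying
   bilinear form is unimodular. Were the quadratic form to represent 1, it would
   be equivalent to x^2 + M x y + y^2 with M = n + k m l - m; by descent along
   Vieta jumps the primitive positive values of that form are 1 and numbers
   >= M + 2 when M >= 3, whereas one of the diagonal values 1 + m l, 1 + m k
   lies strictly in between as soon as k l > 1. For k = l = 1 the form is
   (1 + m) (x + y)^2. *)

Set Implicit Arguments.
Unset Strict Implicit.
Unset Printing Implicit Defensive.
Import Order.TTheory GRing.Theory Num.Theory.
Local Open Scope ring_scope.

(** * Values of unimodular binary forms *)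

(** Descent along Vieta jumps inside the positive quadrant. Coordinates of opposite sign give a
    value of at least [M + 2], and equal positive ones a negative value because [M >= 3]. The
    descent therefore ends on an axis, where primitivity makes the remaining coordinate a unit. *)
Lemma primitive_value_bound (M A : int) : 3 <= M -> 0 < A < M + 2 ->
  forall x y : int, (exists u v : int, u * x + v * y = 1) ->
  x ^+ 2 - M * x * y + y ^+ 2 = A -> A = 1.
Proof.
move=> M3 /andP[A0 AM].
have mixed (x y : int) : 0 < x -> y < 0 -> x ^+ 2 - M * x * y + y ^+ 2 <> A.
  move=> x0 y0 E; have : 1 <= x * - y by nia.
  move=> /(ler_wpM2l (_ : 0 <= M)) => /(_ ltac:(lia)).
  by rewrite !expr2 in E; nia.
have axis (x w : int) : w * x = 1 -> x ^+ 2 = A -> A = 1.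
  move=> /(congr1 absz)/eqP; rewrite abszM muln_eq1 => /andP[_ /eqP x1] <-.
  by rewrite -[x ^+ 2]gez0_abs ?sqr_ge0 // abszX x1.
have pos N : forall x y : int, 0 < x -> 0 < y -> x + y <= N%:Z ->
    (exists u v : int, u * x + v * y = 1) ->
    x ^+ 2 - M * x * y + y ^+ 2 = A -> A = 1.
  elim: N => [|N IH] x y x0 y0 xyN [u [v uv]] E; first by lia.
  wlog lt_yx : x y u v x0 y0 xyN uv E / y < x.
    move=> W; case: (ltrgtP x y) => [lt|lt|e].
    - by apply: (W y x v u) => //; rewrite 1?addrC // -E; ring.
    - exact: (W x y u v).
    - by subst y; suff: False by []; nia.
  (* For fixed [y], the numbers [x] and [z] are the two roots of the quadratic in the first
     coordinate; their product [y ^+ 2 - A] forces [z < y]. *)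
  pose z := M * y - x.
  have Ez : y ^+ 2 - M * y * z + z ^+ 2 = A by rewrite -E /z; ring.
  have uvz : (v + M * u) * y + (- u) * z = 1 by rewrite -uv /z; ring.
  have xz : x * z = y ^+ 2 - A by rewrite -E /z; ring.
  have lt_zy : z < y.
    rewrite ltNge; apply/negP => yz.
    have : y ^+ 2 <= x * z by rewrite expr2; apply: ler_pM; lia.
    by rewrite xz; lia.
  case: (ltrgtP z 0) => [z0|z0|z0].
  - by case: (mixed _ _ y0 z0 Ez).
  - by apply: (IH y z) => //; [lia|exists (v + M * u), (- u)].
  - rewrite z0 !mulr0 addr0 in uvz; apply: axis uvz _.
    by rewrite -Ez z0; ring.
move=> x y [u [v uv]] E.
have E' : y ^+ 2 - M * y * x + x ^+ 2 = A by rewrite -E; ring.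
have [x0|x0|x0] := ltrgtP x 0; last first.
- by rewrite x0 mulr0 add0r in uv; apply: axis uv _; rewrite -E x0; ring.
- have [y0|y0|y0] := ltrgtP y 0; last first.
  + by rewrite y0 mulr0 addr0 in uv; apply: axis uv _; rewrite -E y0; ring.
  + by apply: (pos (absz (x + y)) x y) => //; [lia|exists u, v].
  + by case: (mixed _ _ x0 y0 E).
have [y0|y0|y0] := ltrgtP y 0; last first.
- by rewrite y0 mulr0 addr0 in uv; apply: axis uv _; rewrite -E y0; ring.
- by case: (mixed _ _ y0 x0 E').
apply: (pos (absz (- x - y)) (- x) (- y)) => //; [lia|lia|lia| |].
  by exists (- u), (- v); rewrite !mulrNN.
by rewrite -E; ring.
Qed.

(* With [al = a x + b y] the vector [(1, 0)] is written in the basis formed by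
   [(x, y)] and its orthogonal; both have self-pairing 1. *)
Lemma unimodular_form_neq1 (a b c d : int) : a * d - b * c = 1 ->
  3 <= b - c -> 1 < a < b - c + 2 ->
  forall x y : int, a * x ^+ 2 + (b + c) * x * y + d * y ^+ 2 != 1.
Proof.
move=> det M3 /andP[a1 aM] x y; apply/eqP => E.
suff : a = 1 by lia.
have {}a1 : 0 < a < b - c + 2 by rewrite aM andbT; lia.
apply: (primitive_value_bound M3 a1 (x := a * x + b * y) (y := y)).
  (* With these Bezout coefficients the required identity is [E] itself. *)
  by exists x, (c * x + d * y); rewrite -E; ring.
have -> : (a * x + b * y) ^+ 2 - (b - c) * (a * x + b * y) * y + y ^+ 2
  = a * (a * x ^+ 2 + (b + c) * x * y + d * y ^+ 2)
    + (1 - (a * d - b * c)) * y ^+ 2 by ring.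
by rewrite E det; ring.
Qed.

(** The Gram matrix has diagonal entries [1 + m * l], [1 + m * k], off-diagonal entries [b], [m],
    and determinant 1. The first diagonal entry falls in the excluded range when [k > 1]; when
    [l > 1] the second one does, and the variables are exchanged. *)
Lemma euler_form_neq1 (m k l : nat) : (0 < m)%N -> (0 < k)%N -> (0 < l)%N ->
  forall x y : int,
    (1 + m * l)%:Z * x ^+ 2 + ((k + l + k * m * l)%:Z + m%:Z) * x * y
      + (1 + m * k)%:Z * y ^+ 2 != 1.
Proof.
move=> m0 k0 l0 x y; pose b : int := (k + l + k * m * l)%:Z.
have det : (1 + m * l)%:Z * (1 + m * k)%:Z - b * m%:Z = 1.
  by rewrite /b !(PoszD, PoszM); ring.
have det' : (1 + m * k)%:Z * (1 + m * l)%:Z - b * m%:Z = 1.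
  by rewrite -det mulrC.
have [k2|k1] := ltnP 1 k.
  have mkl : (m * l + m <= k * m * l)%N by nia.
  by apply: (unimodular_form_neq1 det); lia.
have [l2|l1] := ltnP 1 l.
  have mkl : (m * k + m <= k * m * l)%N by nia.
  have := @unimodular_form_neq1 _ _ _ _ det' _ _ y x.
  rewrite [X in X != 1](_ : _ = (1 + m * l)%:Z * x ^+ 2 + (b + m%:Z) * x * y
      + (1 + m * k)%:Z * y ^+ 2); last by ring.
  by apply; lia.
have -> : k = 1%N by lia.
have -> : l = 1%N by lia.
apply/eqP => E; have : (1 + m%:Z) * (x + y) ^+ 2 = 1.
  by rewrite -[RHS]E !(PoszD, PoszM); ring.
move=> /(congr1 absz)/eqP; rewrite abszM muln_eq1 => /andP[/eqP m1 _].
by lia.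
Qed.

(** * Linear algebra *)

(** A two-periodic complex, exact at [V], whose homology at [U] is the line of [u]. By rank-nullity
    [dim V] is the sum of the ranks of [A] and [B], and [dim U] is one more. *)
Lemma periodic_complex_dim (K : fieldType) (U V : vectType K)
    (A : {linear U -> V}) (B : {linear V -> U}) (u : U) :
  (forall x, B (A x) = 0) -> (forall y, B y = 0 -> exists x, y = A x) ->
  (forall y, A (B y) = 0) ->
  (forall x, A x = 0 -> exists c y, x = c *: u + B y) ->
  A u = 0 -> (forall y, B y <> u) -> dim U = (dim V).+1.
Proof.
move=> BA kerB AB kerA Au Bu.
pose fA := linfun A; pose fB := linfun B.
have EA x : fA x = A x by rewrite lfunE.
have EB x : fB x = B x by rewrite lfunE.
have kerBE : lker fB = limg fA.
  apply/vspaceP => y; rewrite memv_ker EB; apply/eqP/memv_imgP.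
    by move=> /kerB[x ->]; exists x; rewrite ?memvf ?EA.
  by case=> x _ ->; rewrite EA BA.
have kerAE : lker fA = (<[u]> + limg fB)%VS.
  apply/vspaceP => x; rewrite memv_ker EA; apply/eqP/memv_addP.
    move=> /kerA[c [y ->]]; exists (c *: u); first exact/memvZ/memv_line.
    by exists (B y) => //; rewrite -EB memv_img ?memvf.
  case=> _ /vlineP[c ->] [_ /memv_imgP[y _ ->] ->].
  by rewrite EB linearD linearZ /= Au AB scaler0 addr0.
have := limg_ker_dim fA fullv; have := limg_ker_dim fB fullv.
rewrite !capfv kerBE kerAE dimv_disjoint_sum; last first.
  apply/eqP; rewrite -subv0; apply/subvP => x.
  rewrite memv_cap => /andP[/vlineP[c ->] /memv_imgP[y _]].
  rewrite EB memv0 => E; have [->|c0] := eqVneq c 0; first by rewrite scale0r.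
  by case: (Bu (c^-1 *: y)); rewrite linearZ /= -E scalerA mulVf ?scale1r.
rewrite dim_vline !dimvf; have -> : u != 0.
  by apply/eqP => u0; apply: (Bu 0); rewrite linear0.
by move=> <- <-; rewrite -addnA add1n addnC.
Qed.

Lemma dim_ffun (K : fieldType) (X : finType) : dim {ffun X -> K^o} = #|X|.
Proof. by rewrite /dim /= muln1. Qed.

(** Here [pi] is the quotient map by [U], written in a basis of a complement of [U], and [sec] lifts
    back into that complement; matrices act on row vectors from the right. *)
Lemma quotient_coordinates (K : fieldType) (n d : nat)
    (U : {vspace 'rV[K]_n}) : (\dim U + d = n)%N ->
  exists pi : 'M[K]_(n, d), exists sec : 'M[K]_(d, n),
    [/\ sec *m pi = 1%:M, forall c, c - c *m pi *m sec \in U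
      & forall c, c \in U -> c *m pi = 0].
Proof.
move=> dimU; pose C := (U^C)%VS.
have dimC : \dim C = d.
  by rewrite dimv_compl dimvf /dim /= mul1n; lia.
have UC0 : (C :&: U = 0)%VS by rewrite capvC capv_compl.
pose f := daddv_pi C U; have [X defX XC] : exists2 X : d.-tuple 'rV[K]_n,
    basis_of C X & True by rewrite -dimC; exists (vbasis C); rewrite ?vbasisP.
have freeX := basis_free defX.
pose pi : 'M[K]_(n, d) := \matrix_(j, s) coord X s (f (delta_mx 0 j)).
pose sec : 'M[K]_(d, n) := \matrix_s X`_s.
have piE c s : (c *m pi) 0 s = coord X s (f c).
  rewrite [in RHS](row_sum_delta c) !linear_sum mxE; apply: eq_bigr => j _.
  by rewrite !linearZ /= mxE.
have secE c : c *m pi *m sec = f c.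
  have fC : f c \in C by exact: memv_pi.
  rewrite [RHS](coord_basis defX fC) mulmx_sum_row; apply: eq_bigr => s _.
  by rewrite piE rowK.
exists pi, sec; split=> [|c|c Uc].
- apply/row_matrixP => s; apply/rowP => t; rewrite row_mul piE rowK.
  rewrite daddv_pi_id ?coord_free ?row1 ?mxE //.
    by rewrite eqxx /= eq_sym -(inj_eq val_inj).
  by rewrite (basis_mem defX) ?mem_nth ?size_tuple.
- have UCc : c \in (C + U)%VS by rewrite addvC addv_complf memvf.
  rewrite secE -{1}(daddv_pi_add UC0 UCc) addrC addKr.
  exact: memv_pi.
- apply/rowP => s; rewrite piE mxE (_ : f c = 0) ?linear0 //.
  have UCc : c \in (C + U)%VS by rewrite addvC addv_complf memvf.
  have := daddv_pi_add UC0 UCc; rewrite (@daddv_pi_id _ _ U C) // 1?capvC //.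
  by move=> /(canRL (addrK _)); rewrite subrr.
Qed.

(** * The algebra attached to a family of subspaces *)

(* A split basic algebra: [rad d] stands for the d-th power of the radical, and
   [elt], [coo] are a basis of [idm v * R * idm w] and its coordinates. *)
Record basic_algebra (K : fieldType) (R : algType K) (T : finType) :=
  BasicAlgebra {
  idm : T -> R;
  idmM : forall v w, idm v * idm w = if v == w then idm v else 0;
  idm_sum : \sum_v idm v = 1;
  rad : nat -> R -> Prop;
  rad0 : forall d, rad d 0;
  radD : forall d x y, rad d x -> rad d y -> rad d (x + y);
  radM : forall d e x y, rad d x -> rad e y -> rad (d + e) (x * y);
  rad_all : forall x, rad 0 x;
  rad_nil : exists d, forall x, rad d x -> x = 0;
  rad_local : forall v w x, exists a j, rad 1 j /\
    idm v * x * idm w = (if v == w then a *: idm v else 0) + j;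
  ind : T -> T -> finType;
  elt : forall v w, ind v w -> R;
  elt_idm : forall v w (z : ind v w), idm v * elt z * idm w = elt z;
  coo : forall v w, ind v w -> {linear R -> K^o};
  coo_elt : forall v w (z z' : ind v w), coo z (elt z') = (z == z')%:R;
  elt_coo : forall v w x,
    idm v * x * idm w = \sum_(z : ind v w) coo z (idm v * x * idm w) *: elt z }.

Inductive lspan (K : pzRingType) (A : lmodType K) (S : A -> Prop) : A -> Prop :=
| lspan_nil : lspan S 0
| lspan_cons a s x : S s -> lspan S x -> lspan S (a *: s + x).

Section LinearSpan.
Variables (K : pzRingType) (A : lmodType K).
Implicit Types (S : A -> Prop).

Lemma lspan_gen S s : S s -> lspan S s.
Proof. by move=> Ss; rewrite -[s]scale1r -[_ *: s]addr0; do 2?constructor. Qed.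

Lemma lspanD S x y : lspan S x -> lspan S y -> lspan S (x + y).
Proof.
move=> Sx Sy; elim: Sx => [|a s z Ss _ IH]; first by rewrite add0r.
by rewrite -addrA; constructor.
Qed.

Lemma lspanZ S a x : lspan S x -> lspan S (a *: x).
Proof.
elim=> [|b s y Ss _ IH]; first by rewrite scaler0; constructor.
by rewrite scalerDr scalerA; constructor.
Qed.
End LinearSpan.

Lemma lspanM (K : pzRingType) (A : algType K) (S T U : A -> Prop) :
  (forall s t, S s -> T t -> lspan U (s * t)) ->
  forall x y, lspan S x -> lspan T y -> lspan U (x * y).
Proof.
move=> ST x y; elim=> [|a s x' Ss _ IH] Ty; first by rewrite mul0r; constructor.
rewrite mulrDl -scalerAl; apply: lspanD (IH Ty); apply: lspanZ.
elim: Ty => [|b t y' Tt _ IH']; first by rewrite mulr0; constructor.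
by rewrite mulrDr -scalerAr; apply: lspanD IH'; apply/lspanZ/ST.
Qed.

Lemma quot_alg_functional (K : fieldType) (A : algType K) (J : proper_tsi A)
    (F : {linear A -> K^o}) : (forall x, J x -> F x = 0) ->
  exists f : {linear quot_alg J -> K^o}, forall x, f (alg_class J x) = F x.
Proof.
move=> FJ; pose f (u : quot_alg J) : K^o := F (sval (cid (alg_class_surj u))).
have fE x : f (alg_class J x) = F x.
  rewrite /f; case: cid => y /= /alg_classP/FJ.
  by rewrite linearB => /subr0_eq.
have flin : linear f.
  move=> a u v; have [x <-] := alg_class_surj u.
  by have [y <-] := alg_class_surj v; rewrite -linearP !fE linearP.
pose fL : {linear quot_alg J -> K^o} :=
  HB.pack f (GRing.isLinear.Build _ _ _ _ f flin).
by exists fL.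
Qed.

(** * Linear functionals on a path algebra *)

Section PathFunctional.
Variables (K : fieldType) (Q : quiver) (h : vertex Q -> seq (arrow Q) -> K).
Local Notation path := (@pa_path K Q).

(** A path is recorded by its end vertex and its word, so a functional is the linear extension of
    [h]; the values of [h] on words that are not paths are immaterial. *)
Definition path_functional (x : path_algebra K Q) : K^o :=
  \sum_(p <- msupp x) x@_p * h (ptgt p) (val p).2.

Lemma path_functional_linear : linear path_functional.
Proof.
move=> a x y; set d := (msupp x `|` msupp y)%fset.
have wid z : (msupp z `<=` d)%fset ->
    path_functional z = \sum_(p <- d) z@_p * h (ptgt p) (val p).2.
  move=> le; apply: big_fset_incl => // p _ /mcoeff_outdom ->.
  by rewrite mul0r.
rewrite !wid ?fsubsetUl ?fsubsetUr //; last first.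
  apply/fsubsetP => p; rewrite -mcoeff_neq0 mcoeff_lin => N.
  rewrite in_fsetU -!mcoeff_neq0; apply: contraNT N.
  by rewrite negb_or !negbK => /andP[/eqP-> /eqP->]; rewrite mulr0 addr0.
rewrite scaler_sumr -big_split /=; apply: eq_bigr => p _.
by rewrite mcoeff_lin mulrDl -mulrA.
Qed.

HB.instance Definition _ := GRing.isLinear.Build K (path_algebra K Q) K^o _
  path_functional path_functional_linear.

Lemma path_functionalE p : path_functional (path p) = h (ptgt p) (val p).2.
Proof.
rewrite /path_functional pa_path.unlock msuppU oner_eq0 big_seq_fset1.
by rewrite mcoeffUU mul1r.
Qed.

Lemma pa_pathM p q : path p * path q = path_mul K p q.
Proof. exact: pa_mulUU. Qed.

Lemma path_functionalM p s q :
  path_functional (path p * path s * path q) =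
    if (psrc p == ptgt s) && (psrc s == ptgt q)
    then h (ptgt p) ((val p).2 ++ (val s).2 ++ (val q).2) else 0.
Proof.
rewrite pa_pathM /path_mul; have := path_compP p s.
case: eqP => [Eps [r -> Er]|_ ->]; last by rewrite mul0r linear0.
have -> : psrc s = psrc r.
  rewrite /psrc Er /= /walk_src map_cat last_cat.
  by rewrite -/(walk_src (ptgt p) (val p).2) -/(psrc p) Eps.
rewrite pa_pathM /path_mul; have := path_compP r q.
case: eqP => [Erq [t -> Et]|_ ->]; last by rewrite linear0.
by rewrite path_functionalE /ptgt Et /ptgt Er /= catA.
Qed.
End PathFunctional.

HB.lock Definition RF_class (K : fieldType) (n m : nat)
    (V W : 'I_m -> {vspace 'rV[K]_n}) (x : path_algebra K (quiver_nm n m)) :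
  RF V W := alg_class (RF_ideal V W) x.

Section RFClass.
Variables (K : fieldType) (n m : nat) (V W : 'I_m -> {vspace 'rV[K]_n}).
Local Notation KQ := (path_algebra K (quiver_nm n m)).

Lemma RF_class_linear : linear (RF_class V W).
Proof. by move=> a x y; rewrite RF_class.unlock; exact: alg_class_linear. Qed.

HB.instance Definition _ :=
  GRing.isLinear.Build K KQ (RF V W) _ (RF_class V W) RF_class_linear.

Lemma RF_class0 : RF_class V W 0 = 0.
Proof. exact: linear0. Qed.

Lemma RF_classM x y : RF_class V W (x * y) = RF_class V W x * RF_class V W y.
Proof. rewrite RF_class.unlock; exact: alg_classM. Qed.

Lemma RF_class1 : RF_class V W 1 = 1.
Proof. by rewrite RF_class.unlock. Qed.

Lemma RF_class_ideal x : RF_ideal V W x -> RF_class V W x = 0.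
Proof.
move=> Jx; rewrite RF_class.unlock -(linear0 (alg_class (RF_ideal V W))).
by apply/alg_classP; rewrite subr0.
Qed.

Lemma RF_class_surj u : exists x, RF_class V W x = u.
Proof. rewrite RF_class.unlock; exact: alg_class_surj. Qed.
End RFClass.

(** * Functionals that descend to the quotient by the relations *)

Section RFKill.
Variables (K : fieldType) (n m : nat) (V W : 'I_m -> {vspace 'rV[K]_n}).
Local Notation Q := (quiver_nm n m).
Local Notation KQ := (path_algebra K Q).
Local Notation path := (@pa_path K Q).
Local Notation c_ j := (inl j : arrow Q).
Local Notation b_ i := (inr i : arrow Q).

Lemma path_mul_word (p q r : qpath Q) : psrc p = ptgt q ->
  val r = (ptgt p, (val p).2 ++ (val q).2) -> path p * path q = path r.
Proof.
move=> Epq Er; rewrite pa_pathM /path_mul; have := path_compP p q.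
by rewrite Epq eqxx => -[s -> Es]; congr pa_path; apply: val_inj; rewrite Er.
Qed.

Lemma arrow_cb j i : arrow_c K m j * arrow_b K n i =
  path (exist _ (true, [:: c_ j; b_ i]) isT : qpath Q).
Proof. exact: path_mul_word. Qed.

Lemma arrow_bc i j : arrow_b K n i * arrow_c K m j =
  path (exist _ (false, [:: b_ i; c_ j]) isT : qpath Q).
Proof. exact: path_mul_word. Qed.

Lemma arrow_bcb i j i' : arrow_b K n i * arrow_c K m j * arrow_b K n i' =
  path (exist _ (false, [:: b_ i; c_ j; b_ i']) isT : qpath Q).
Proof. by rewrite arrow_bc; exact: path_mul_word. Qed.

Lemma arrow_cbc j i j' : arrow_c K m j * arrow_b K n i * arrow_c K m j' =
  path (exist _ (true, [:: c_ j; b_ i; c_ j']) isT : qpath Q).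
Proof. by rewrite arrow_cb; exact: path_mul_word. Qed.

Variable h : bool -> seq ('I_n + 'I_m) -> K.
Hypothesis h_bcb : forall v y z i j i',
  h v (y ++ [:: inr i; inl j; inr i'] ++ z) = 0.
Hypothesis h_wb : forall v y z i w, w \in W i ->
  \sum_j w 0 j * h v (y ++ [:: inl j; inr i] ++ z) = 0.
Hypothesis h_bv : forall v y z i w, w \in V i ->
  \sum_j w 0 j * h v (y ++ [:: inr i; inl j] ++ z) = 0.

Local Notation F := (@path_functional K Q h).

(** Expanding the relation multilinearly in the arrows leaves sums of values of [h] on words, one
    hypothesis on [h] for each type of relation. *)
Lemma RF_relation_functional s p q :
  RF_relation V W s -> F (path p * s * path q) = 0.
Proof.
case=> [b c b'|i w Ww|i w Vw].
- have -> : Bvec n b * Cvec m c * Bvec n b' = \sum_i \sum_j \sum_i'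
      (b 0 i * c 0 j * b' 0 i') *:
        (arrow_b K n i * arrow_c K m j * arrow_b K n i').
    rewrite /Bvec /Cvec mulr_suml mulr_suml; apply: eq_bigr => i _.
    rewrite [X in X * _]mulr_sumr mulr_suml; apply: eq_bigr => j _.
    rewrite mulr_sumr; apply: eq_bigr => i' _.
    by rewrite -!scalerAl -!scalerAr -!scalerAl !scalerA mulrAC.
  rewrite mulr_sumr mulr_suml linear_sum big1 // => i _.
  rewrite mulr_sumr mulr_suml linear_sum big1 // => j _.
  rewrite mulr_sumr mulr_suml linear_sum big1 // => i' _.
  rewrite -scalerAr -scalerAl linearZ /= arrow_bcb path_functionalM /= h_bcb.
  by rewrite if_same scaler0.
- rewrite /Cvec mulr_suml mulr_sumr mulr_suml linear_sum /=.
  (* All words of the expansion have the same ends, so composability with [p] and [q] is a common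
     factor. *)
  set k := (psrc p == true) && (true == ptgt q).
  rewrite (eq_bigr (fun j => w 0 j *
    h (ptgt p) ((val p).2 ++ [:: inl j; inr i] ++ (val q).2) * k%:R)).
    by rewrite -mulr_suml h_wb ?mul0r.
  move=> j _; rewrite -scalerAl -scalerAr -scalerAl linearZ /= arrow_cb.
  rewrite path_functionalM /= -mulrA; congr (_ * _).
  by rewrite /k; case: ifP; rewrite ?mulr1 ?mulr0.
rewrite /Cvec mulr_sumr mulr_sumr mulr_suml linear_sum /=.
set k := (psrc p == false) && (false == ptgt q).
rewrite (eq_bigr (fun j => w 0 j *
  h (ptgt p) ((val p).2 ++ [:: inr i; inl j] ++ (val q).2) * k%:R)).
  by rewrite -mulr_suml h_bv ?mul0r.
move=> j _; rewrite -scalerAr -scalerAr -scalerAl linearZ /= arrow_bc.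
rewrite path_functionalM /= -mulrA; congr (_ * _).
by rewrite /k; case: ifP; rewrite ?mulr1 ?mulr0.
Qed.

(* The [x] with [F (y * x * z) = 0] for all [y], [z] form a two-sided ideal, so
   it suffices to test [F] around the relations. *)
Lemma RF_functional : exists f : {linear RF V W -> K^o},
  forall x, f (RF_class V W x) = F x.
Proof.
rewrite RF_class.unlock; apply: quot_alg_functional => x Jx.
suff /(_ 1 1) : forall y z, F (y * x * z) = 0 by rewrite mul1r mulr1.
apply: (Jx (fun x => forall y z, F (y * x * z) = 0)).
  split=> [y z|x1 x2 H1 H2 y z|a x1 H1 y z|a x1 H1 y z].
  - by rewrite mulr0 mul0r linear0.
  - by rewrite mulrDr mulrDl linearD /= H1 H2 addr0.
  - by rewrite mulrA.
  - by rewrite mulrA -mulrA.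
move=> s Ss y z; elim/pa_ind: y => [a y y' Hy Hy'||p].
- by rewrite !mulrDl -!scalerAl linearP /= Hy Hy' scaler0 addr0.
- by rewrite !mul0r linear0.
elim/pa_ind: z => [a z z' Hz Hz'||q].
- by rewrite mulrDr -scalerAr linearP /= Hz Hz' scaler0 addr0.
- by rewrite !mulr0 linear0.
exact: RF_relation_functional.
Qed.
End RFKill.

Lemma big_option (T : finType) (A : nmodType) (F : option T -> A) :
  \sum_z F z = F None + \sum_t F (Some t).
Proof.
rewrite (bigD1 None) //=; congr (_ + _).
by rewrite (reindex_omap Some id) //=; [apply: eq_bigl => t; rewrite eqxx|case].
Qed.

Ltac case_RF_index v w z :=
  case: v w z => [] [] /=;
    [case=> [[? ?]|]|case=> [?|[[? ?] ?]]|move=> ?|case=> [[? ?]|]].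

(** * An explicit basis of the algebra and its radical filtration *)

Section RFBasis.
Variables (K : fieldType) (n m : nat) (V W : 'I_m -> {vspace 'rV[K]_n}).
Variables (k l : nat).
(* [om i] and [la i] are the projection of C onto C / W_i and a section of it;
   [ga i] and [mu i] play the same role for V_i. *)
Variables (om : 'I_m -> 'M[K]_(n, k)) (la : 'I_m -> 'M[K]_(k, n)).
Variables (ga : 'I_m -> 'M[K]_(n, l)) (mu : 'I_m -> 'M[K]_(l, n)).
Hypothesis la_om : forall i, la i *m om i = 1%:M.
Hypothesis om_mod : forall i c, c - c *m om i *m la i \in W i.
Hypothesis om_W : forall i c, c \in W i -> c *m om i = 0.
Hypothesis mu_ga : forall i, mu i *m ga i = 1%:M.
Hypothesis ga_mod : forall i c, c - c *m ga i *m mu i \in V i.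
Hypothesis ga_V : forall i c, c \in V i -> c *m ga i = 0.

Local Notation Q := (quiver_nm n m).
Local Notation KQ := (path_algebra K Q).
Local Notation RF := (RF V W).
Local Notation path := (@pa_path K Q).
Local Notation cls := (RF_class V W).
Local Notation word := (seq ('I_n + 'I_m)).

(** Labels for the classes of paths from [w] to [v]. Since [bcb] vanishes, only trivial paths
    ([None]), [b], [c], [bc], [cb] and [cbc] survive; a factor [c] before [b i] counts only modulo
    [W i], giving [k] choices, and one after [b i] only modulo [V i], giving [l] choices. *)
Definition RF_index (v w : bool) : finType :=
  match v, w with
  | false, false => option ('I_m * 'I_l)
  | true, true => option ('I_m * 'I_k)
  | true, false => ('I_n + 'I_k * 'I_m * 'I_l)%type
  | false, true => 'I_m
  end.

Definition RF_elt (v w : bool) : RF_index v w -> KQ :=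
  match v, w return RF_index v w -> KQ with
  | false, false => fun z => if z is Some (i, r)
      then arrow_b K n i * Cvec m (row r (mu i))
      else pa_vertex K (false : vertex Q)
  | true, true => fun z => if z is Some (i, s)
      then Cvec m (row s (la i)) * arrow_b K n i
      else pa_vertex K (true : vertex Q)
  | true, false => fun z => match z with
      | inl j => arrow_c K m j
      | inr (s, i, r) =>
          Cvec m (row s (la i)) * arrow_b K n i * Cvec m (row r (mu i))
      end
  | false, true => fun i => arrow_b K n i
  end.

(** The dual basis, given on words: [om] and [ga] read off coordinates modulo [W i] and [V i]. The
    vertex argument is consulted only for the empty word, whose end the letters do not determine. *)
Definition RF_coef (v w : bool) : RF_index v w -> bool -> word -> K :=
  match v, w return RF_index v w -> bool -> word -> K with
  | false, false => fun z u ws => match z, ws with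
      | None, [::] => (~~ u)%:R
      | Some (i, r), [:: inr i'; inl j] => (i' == i)%:R * ga i j r
      | _, _ => 0 end
  | true, true => fun z u ws => match z, ws with
      | None, [::] => u%:R
      | Some (i, s), [:: inl j; inr i'] => (i' == i)%:R * om i j s
      | _, _ => 0 end
  | true, false => fun z _ ws => match z, ws with
      | inl j, [:: inl j'] => (j' == j)%:R
      | inr (s, i, r), [:: inl j; inr i'; inl j'] =>
          (i' == i)%:R * om i j s * ga i j' r
      | _, _ => 0 end
  | false, true => fun i _ ws => if ws is [:: inr i'] then (i' == i)%:R else 0
  end.

Lemma RF_coef_bcb v w (z : RF_index v w) u y t i j i' :
  RF_coef z u (y ++ [:: inr i; inl j; inr i'] ++ t) = 0.
Proof.
by case_RF_index v w z; case: y => [|[?|?] [|[?|?] [|[?|?] [|? ?]]]].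
Qed.

Lemma sum_om i i' w s : w \in W i' ->
  \sum_j w 0 j * ((i' == i)%:R * om i j s) = 0.
Proof.
move=> Ww; have [Ei|_] := eqVneq i' i; last first.
  by rewrite big1 // => j _; rewrite mul0r mulr0.
move/matrixP/(_ 0 s): (om_W Ww); rewrite Ei !mxE => E; rewrite -[RHS]E.
by apply: eq_bigr => j _; rewrite mul1r.
Qed.

Lemma sum_ga i i' w r : w \in V i' ->
  \sum_j w 0 j * ((i' == i)%:R * ga i j r) = 0.
Proof.
move=> Vw; have [Ei|_] := eqVneq i' i; last first.
  by rewrite big1 // => j _; rewrite mul0r mulr0.
move/matrixP/(_ 0 r): (ga_V Vw); rewrite Ei !mxE => E; rewrite -[RHS]E.
by apply: eq_bigr => j _; rewrite mul1r.
Qed.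

(** A word containing [cb] can have a nonzero coefficient only if it is [cb] or [cbc]. Summing over
    its first letter then produces a coordinate of [c *m om i], which is zero on [W i]. *)
Lemma RF_coef_wb v w (z : RF_index v w) u y t i c : c \in W i ->
  \sum_j c 0 j * RF_coef z u (y ++ [:: inl j; inr i] ++ t) = 0.
Proof.
move=> Wc; case_RF_index v w z;
  case: y => [|[?|?] [|[?|?] [|[?|?] [|? ?]]]]; case: t => [|[?|?] [|? ?]] /=;
  try by apply: big1 => j _; rewrite mulr0.
- exact: sum_om.
- under eq_bigr do rewrite mulrA.
  by rewrite -mulr_suml sum_om ?mul0r.
Qed.

Lemma RF_coef_bv v w (z : RF_index v w) u y t i c : c \in V i ->
  \sum_j c 0 j * RF_coef z u (y ++ [:: inr i; inl j] ++ t) = 0.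
Proof.
move=> Vc; case_RF_index v w z;
  case: y => [|[?|?] [|[?|?] [|[?|?] [|? ?]]]]; case: t => [|[?|?] [|? ?]] /=;
  try by apply: big1 => j _; rewrite mulr0.
- under eq_bigr do rewrite mulrAC mulrA.
  by rewrite -mulr_suml sum_ga ?mul0r.
- exact: sum_ga.
Qed.

Lemma RF_coord_exists v w (z : RF_index v w) :
  exists f : {linear RF -> K^o},
    forall x, f (cls x) = @path_functional K Q (RF_coef z) x.
Proof.
apply: RF_functional => *.
- exact: RF_coef_bcb.
- exact: RF_coef_wb.
- exact: RF_coef_bv.
Qed.

Definition RF_coord v w (z : RF_index v w) : {linear RF -> K^o} :=
  sval (cid (RF_coord_exists z)).

Lemma RF_coordE v w (z : RF_index v w) x :
  RF_coord z (cls x) = @path_functional K Q (RF_coef z) x.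
Proof. exact: (svalP (cid (RF_coord_exists z))). Qed.

Section Pairing.
Variable h : bool -> word -> K.
Local Notation F := (@path_functional K Q h).

Lemma functional_bC i c : F (arrow_b K n i * Cvec m c) =
  \sum_j c 0 j * h false [:: inr i; inl j].
Proof.
rewrite /Cvec mulr_sumr linear_sum; apply: eq_bigr => j _.
by rewrite -scalerAr linearZ /= arrow_bc path_functionalE.
Qed.

Lemma functional_Cb c i : F (Cvec m c * arrow_b K n i) =
  \sum_j c 0 j * h true [:: inl j; inr i].
Proof.
rewrite /Cvec mulr_suml linear_sum; apply: eq_bigr => j _.
by rewrite -scalerAl linearZ /= arrow_cb path_functionalE.
Qed.

Lemma functional_CbC c i d : F (Cvec m c * arrow_b K n i * Cvec m d) =
  \sum_j \sum_j' c 0 j * d 0 j' * h true [:: inl j; inr i; inl j'].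
Proof.
rewrite {1}/Cvec !mulr_suml linear_sum; apply: eq_bigr => j _.
rewrite mulr_sumr linear_sum; apply: eq_bigr => j' _.
rewrite -!scalerAl -scalerAr !linearZ /= arrow_cbc path_functionalE.
by rewrite /= scalerA.
Qed.
End Pairing.

Lemma sum_la_om i' i s' s : \sum_j la i' s' j * ((i' == i)%:R * om i j s) =
  ((i' == i) && (s' == s))%:R.
Proof.
have [Ei|_] := eqVneq i' i; last by rewrite big1 // => j _; rewrite mul0r mulr0.
have /matrixP/(_ s' s) := la_om i; rewrite !mxE Ei => <-.
by apply: eq_bigr => j _; rewrite mul1r.
Qed.

Lemma sum_mu_ga i' i r' r : \sum_j mu i' r' j * ((i' == i)%:R * ga i j r) =
  ((i' == i) && (r' == r))%:R.
Proof.
have [Ei|_] := eqVneq i' i; last by rewrite big1 // => j _; rewrite mul0r mulr0.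
have /matrixP/(_ r' r) := mu_ga i; rewrite !mxE Ei => <-.
by apply: eq_bigr => j _; rewrite mul1r.
Qed.

Lemma RF_coord_elt v w (z z' : RF_index v w) :
  RF_coord z (cls (RF_elt z')) = (z == z')%:R.
Proof.
rewrite RF_coordE eq_sym; move: z z'; case: v w => [] [] /=.
- case=> [[i s]|] [[i' s']|]; rewrite ?functional_Cb ?path_functionalE //=.
  + under eq_bigr do rewrite mxE.
    by rewrite sum_la_om.
  + by rewrite big1 // => j _; rewrite mulr0.
- case=> [j|[[s i] r]] [j'|[[s' i'] r']];
    rewrite ?functional_CbC ?path_functionalE //=.
    by rewrite big1 // => ? _; rewrite big1 // => ? _; rewrite mulr0.
  rewrite (eq_bigr (fun a => \sum_b la i' s' a * mu i' r' b *
    ((i' == i)%:R * om i a s * ga i b r))) => [|a _]; last first.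
    by apply: eq_bigr => b _; rewrite !mxE.
  (* The double sum separates into two Kronecker sums; the test [i' == i] may be repeated in both
     because it is idempotent. *)
  transitivity ((\sum_j la i' s' j * ((i' == i)%:R * om i j s)) *
    (\sum_j mu i' r' j * ((i' == i)%:R * ga i j r))).
    rewrite mulr_suml; apply: eq_bigr => a _; rewrite mulr_sumr.
    apply: eq_bigr => b _; case: (i' == i); rewrite ?(mul0r, mulr0) //.
    by rewrite !mul1r mulrACA.
  rewrite sum_la_om sum_mu_ga -natrM mulnb; congr (_%:R).
  rewrite [inr _ == _](_ : _ = ((s', i', r') == (s, i, r))) // !xpair_eqE.
  by case: (i' == i) (s' == s) => [] [].
- by move=> i i'; rewrite path_functionalE.
- case=> [[i s]|] [[i' s']|]; rewrite ?functional_bC ?path_functionalE //=.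
  + under eq_bigr do rewrite mxE.
    by rewrite sum_mu_ga.
  + by rewrite big1 // => j _; rewrite mulr0.
Qed.

Local Notation e_ v := (cls (pa_vertex K (v : vertex Q))).
Local Notation qp v ws H := (exist _ (v, ws) H : qpath Q).

Lemma Cvec_linear : linear (@Cvec K n m).
Proof.
move=> a x y; rewrite /Cvec scaler_sumr -big_split; apply: eq_bigr => j _ /=.
by rewrite !mxE scalerDl scalerA.
Qed.

Lemma Cvec_delta (j : 'I_n) : Cvec m (delta_mx 0 j : 'rV[K]_n) = arrow_c K m j.
Proof.
rewrite /Cvec (bigD1 j) //= mxE !eqxx scale1r big1 ?addr0 // => j' /negPf Nj.
by rewrite mxE eqxx Nj scale0r.
Qed.

(** Such an [f] factors through the quotient by [U], so [c] may be replaced by the lift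
    [c *m pi *m sec] of its class. *)
Lemma linear_mod_expand d (A : lmodType K) (f : 'rV[K]_n -> A)
    (U : {vspace 'rV[K]_n}) (pi : 'M_(n, d)) (sec : 'M_(d, n)) c :
  linear f -> (forall x, x \in U -> f x = 0) -> c - c *m pi *m sec \in U ->
  f c = \sum_s (c *m pi) 0 s *: f (row s sec).
Proof.
move=> flin fU Uc.
pose fL : {linear 'rV[K]_n -> A} :=
  HB.pack f (GRing.isLinear.Build _ _ _ _ f flin).
have -> : f c = fL (c *m pi *m sec).
  by apply/subr0_eq; rewrite -[f c]/(fL c) -linearB; apply: fU.
rewrite mulmx_sum_row linear_sum; apply: eq_bigr => s _.
by rewrite linearZ.
Qed.

Lemma cls_Cb c i : cls (Cvec m c * arrow_b K n i) =
  \sum_s (c *m om i) 0 s *: cls (Cvec m (row s (la i)) * arrow_b K n i).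
Proof.
pose f (x : 'rV[K]_n) := cls (Cvec m x * arrow_b K n i).
apply: (@linear_mod_expand _ RF f (W i)) => [a x y|x Wx|].
- by rewrite /f Cvec_linear mulrDl -scalerAl RF_class_linear.
- by apply: RF_class_ideal; apply: generated_ideal_incl; exact: RF_wb.
- exact: om_mod.
Qed.

Lemma cls_bC c i : cls (arrow_b K n i * Cvec m c) =
  \sum_r (c *m ga i) 0 r *: cls (arrow_b K n i * Cvec m (row r (mu i))).
Proof.
pose f (x : 'rV[K]_n) := cls (arrow_b K n i * Cvec m x).
apply: (@linear_mod_expand _ RF f (V i)) => [a x y|x Vx|].
- by rewrite /f Cvec_linear mulrDr -scalerAr RF_class_linear.
- by apply: RF_class_ideal; apply: generated_ideal_incl; exact: RF_bv.
- exact: ga_mod.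
Qed.

Lemma delta_mulE d (A : 'M[K]_(n, d)) (j : 'I_n) s :
  ((delta_mx 0 j : 'rV[K]_n) *m A) 0 s = A j s.
Proof. by rewrite -rowE mxE. Qed.

Lemma cls_bcb0 (p : qpath Q) y t i j i' :
  (val p).2 = y ++ [:: inr i; inl j; inr i'] ++ t -> cls (path p) = 0.
Proof.
case: p => -[v ws] H /= E; subst ws; have := H.
rewrite walk_cat => /andP[Hy /= /andP[/eqP sy Ht]].
have -> : path (qp v _ H) = path (qp v y Hy) *
    (arrow_b K n i * arrow_c K m j * arrow_b K n i') * path (qp true t Ht).
  rewrite arrow_bcb -mulrA.
  have Hb : walk (false : vertex Q) ([:: inr i; inl j; inr i'] ++ t) by [].
  rewrite (@path_mul_word K n m _ _ (qp false _ Hb)) //.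
  by rewrite (@path_mul_word K n m _ _ (qp v _ H)).
have TJ := tsi_ideal (RF_ideal V W).
apply: RF_class_ideal; apply: (tsiMr TJ); apply: (tsiMl TJ).
apply: generated_ideal_incl.
have -> : arrow_b K n i = Bvec n (delta_mx 0 i : 'rV[K]_m).
  rewrite /Bvec (bigD1 i) //= mxE !eqxx scale1r big1 ?addr0 // => i1 /negPf Ni.
  by rewrite mxE eqxx Ni scale0r.
have -> : arrow_b K n i' = Bvec n (delta_mx 0 i' : 'rV[K]_m).
  rewrite /Bvec (bigD1 i') //= mxE !eqxx scale1r big1 ?addr0 // => i1 /negPf Ni.
  by rewrite mxE eqxx Ni scale0r.
rewrite -Cvec_delta; exact: RF_bcb.
Qed.

Lemma sum_pick_first (I J : finType) (A : lmodType K) (F : I -> J -> K)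
    (G : I -> J -> A) i :
  \sum_(p : I * J) ((i == p.1)%:R * F p.1 p.2) *: G p.1 p.2 =
  \sum_j F i j *: G i j.
Proof.
rewrite -(pair_bigA _ (fun a b => ((i == a)%:R * F a b) *: G a b)) /=.
rewrite (bigD1 i) //= [X in _ + X]big1 ?addr0 => [|a /negPf Na].
  by apply: eq_bigr => j _; rewrite eqxx mul1r.
by rewrite big1 // => j _; rewrite eq_sym Na mul0r scale0r.
Qed.

Lemma cls_cb j i : cls (path (qp true [:: inl j; inr i] isT)) =
  \sum_s om i j s *: cls (Cvec m (row s (la i)) * arrow_b K n i).
Proof.
have := cls_Cb (delta_mx 0 j) i; rewrite Cvec_delta arrow_cb => ->.
by apply: eq_bigr => s _; rewrite delta_mulE.
Qed.

Lemma cls_bc i j : cls (path (qp false [:: inr i; inl j] isT)) =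
  \sum_r ga i j r *: cls (arrow_b K n i * Cvec m (row r (mu i))).
Proof.
have := cls_bC (delta_mx 0 j) i; rewrite Cvec_delta arrow_bc => ->.
by apply: eq_bigr => s _; rewrite delta_mulE.
Qed.

Lemma cls_cbc j i j' : cls (path (qp true [:: inl j; inr i; inl j'] isT)) =
  \sum_s \sum_r (om i j s * ga i j' r) *:
    cls (Cvec m (row s (la i)) * arrow_b K n i * Cvec m (row r (mu i))).
Proof.
rewrite -arrow_cbc -mulrA RF_classM arrow_bc cls_bc mulr_sumr exchange_big.
apply: eq_bigr => r _; rewrite -scalerAr -RF_classM mulrA RF_classM.
rewrite arrow_cb cls_cb mulr_suml scaler_sumr; apply: eq_bigr => s _.
by rewrite -scalerAl scalerA mulrC -RF_classM.
Qed.

(** Arrows [b] and [c] alternate along a path, so four consecutive arrows contain some [bcb]. *)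
Lemma cls_path_long (p : qpath Q) : (3 < size (val p).2)%N -> cls (path p) = 0.
Proof.
case Ep: (val p) => [v ws]; have := valP p; rewrite Ep /=.
case: v ws Ep => [] [|[j1|i1] [|[j2|i2] [|[j3|i3] [|[j4|i4] ws]]]] Ep //= _ _.
- by apply: (cls_bcb0 (y := [:: inl j1]) (t := ws)); rewrite Ep.
- by apply: (cls_bcb0 (y := [::]) (t := inl j4 :: ws)); rewrite Ep.
Qed.

Lemma RF_coef_long v w (z : RF_index v w) u ws : (3 < size ws)%N ->
  RF_coef z u ws = 0.
Proof.
by case_RF_index v w z; case: ws => [|[?|?] [|[?|?] [|[?|?] [|? ?]]]].
Qed.

(** Spanning: paths of length at most three are listed by length and end vertex, and each is
    rewritten modulo [W i] and [V i] in terms of the chosen sections. *)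
Lemma cls_path_expand v ws H : cls (path (qp v ws H)) =
  \sum_(z : RF_index v (walk_src (v : vertex Q) ws))
    RF_coef z v ws *: cls (RF_elt z).
Proof.
have [long|] := ltnP 3 (size ws).
  by rewrite cls_path_long ?big1 // => z _; rewrite RF_coef_long ?scale0r.
have path_eq q : val q = (v, ws) -> path (qp v ws H) = path q.
  by move=> E; congr pa_path; exact: val_inj.
move: H path_eq; rewrite /walk_src.
case: ws => [|[j1|i1] [|[j2|i2] [|[j3|i3] [|a ws]]]] //;
  case: v => //= H path_eq _.
- rewrite big_option scale1r big1 ?addr0 => [|[i s] _]; last by rewrite scale0r.
  by rewrite (path_eq (path_nil (true : vertex Q))).
- rewrite big_option scale1r big1 ?addr0 => [|[i s] _]; last by rewrite scale0r.
  by rewrite (path_eq (path_nil (false : vertex Q))).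
- rewrite big_sumType /= [X in _ + X]big1 ?addr0 => [|[[s i] r] _]; last first.
    by rewrite scale0r.
  rewrite (bigD1 j1) //= eqxx scale1r big1 ?addr0 => [|j /negPf Nj].
    by rewrite (path_eq (path_arrow (inl j1 : arrow Q))).
  by rewrite eq_sym Nj scale0r.
- rewrite big_option scale0r add0r.
  rewrite (eq_bigr (fun p => ((i2 == p.1)%:R * om p.1 j1 p.2) *:
    cls (Cvec m (row p.2 (la p.1)) * arrow_b K n p.1))) => [|[i s] _] //.
  rewrite (sum_pick_first (fun i s => om i j1 s)
    (fun i s => cls (Cvec m (row s (la i)) * arrow_b K n i))).
  by rewrite (path_eq (qp true [:: inl j1; inr i2] isT)) //; exact: cls_cb.
- rewrite big_sumType /= [X in X + _]big1 ?add0r => [|j _]; last first.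
    by rewrite scale0r.
  pose F i s r := (om i j1 s * ga i j3 r) *:
    cls (Cvec m (row s (la i)) * arrow_b K n i * Cvec m (row r (mu i))).
  rewrite (eq_bigr (fun p => (i2 == p.1.2)%:R *: F p.1.2 p.1.1 p.2));
    last by case=> [[s i] r] _; rewrite /F scalerA mulrA.
  rewrite -(pair_bigA _ (fun a r => (i2 == a.2)%:R *: F a.2 a.1 r)) /=.
  rewrite -(pair_bigA _ (fun s i => \sum_r (i2 == i)%:R *: F i s r)) /=.
  rewrite (path_eq (qp true [:: inl j1; inr i2; inl j3] isT)) //.
  etransitivity; first exact: cls_cbc.
  apply: eq_bigr => s _.
  rewrite [RHS](bigD1 i2) //= [X in _ = _ + X]big1 ?addr0.
    by apply: eq_bigr => r _; rewrite eqxx scale1r.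
  by move=> i /negPf Ni; rewrite big1 // => r _; rewrite eq_sym Ni scale0r.
- rewrite (bigD1 i1) //= eqxx scale1r big1 ?addr0 => [|i /negPf Ni].
    by rewrite (path_eq (path_arrow (inr i1 : arrow Q))).
  by rewrite eq_sym Ni scale0r.
- rewrite big_option scale0r add0r.
  rewrite (eq_bigr (fun p => ((i1 == p.1)%:R * ga p.1 j2 p.2) *:
    cls (arrow_b K n p.1 * Cvec m (row p.2 (mu p.1))))) => [|[i s] _] //.
  rewrite (sum_pick_first (fun i s => ga i j2 s)
    (fun i s => cls (arrow_b K n i * Cvec m (row s (mu i))))).
  by rewrite (path_eq (qp false [:: inr i1; inl j2] isT)) //; exact: cls_bc.
(* The remaining word is [bcb]: its class and all its coefficients are zero. *)
- rewrite (cls_bcb0 (y := [::]) (t := [::]) (i := i1) (j := j2) (i' := i3)) //.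
  by rewrite big1 // => i _; rewrite scale0r.
Qed.

Lemma vertex_path (v : vertex Q) p :
  pa_vertex K v * path p = if v == ptgt p then path p else 0.
Proof. by rewrite /pa_vertex pa_pathM path_mul_nill. Qed.

Lemma path_vertex (v : vertex Q) p :
  path p * pa_vertex K v = if psrc p == v then path p else 0.
Proof. by rewrite /pa_vertex pa_pathM path_mul_nilr. Qed.

Lemma RF_elt_idm v w (z : RF_index v w) :
  pa_vertex K (v : vertex Q) * RF_elt z * pa_vertex K (w : vertex Q) = RF_elt z.
Proof.
have vC c : pa_vertex K (true : vertex Q) * Cvec m c = Cvec m c.
  by rewrite mulr_sumr; apply: eq_bigr => j _; rewrite -scalerAr vertex_path.
have Cv c : Cvec m c * pa_vertex K (false : vertex Q) = Cvec m c.
  by rewrite mulr_suml; apply: eq_bigr => j _; rewrite -scalerAl path_vertex.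
have vb i : pa_vertex K (false : vertex Q) * arrow_b K n i = arrow_b K n i.
  by rewrite vertex_path.
have bv i : arrow_b K n i * pa_vertex K (true : vertex Q) = arrow_b K n i.
  by rewrite path_vertex.
have vv (v0 : vertex Q) : pa_vertex K v0 * pa_vertex K v0 = pa_vertex K v0.
  by rewrite vertex_path eqxx.
have ends (e x y f : KQ) : e * x = x -> y * f = y -> e * (x * y) * f = x * y.
  by move=> ex yf; rewrite mulrA ex -mulrA yf.
case: v w z => [] [] /=.
- by case=> [[i s]|]; [apply: ends|rewrite !vv].
- case=> [j|[[s i] r]]; first by rewrite vertex_path path_vertex.
  by apply: (ends _ _ _ _ _ (Cv _)); rewrite mulrA vC.
- by move=> i; rewrite vb bv.
- by case=> [[i r]|]; [apply: ends|rewrite !vv].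
Qed.

Lemma RF_elt_coord v w (x : RF) : e_ v * x * e_ w =
  \sum_(z : RF_index v w) RF_coord z (e_ v * x * e_ w) *: cls (RF_elt z).
Proof.
have [y <-] := RF_class_surj x; rewrite -!RF_classM.
elim/pa_ind: y => [a y y' Hy Hy'||p].
- rewrite mulrDr mulrDl -scalerAr -scalerAl RF_class_linear {1}Hy {1}Hy'.
  rewrite scaler_sumr -big_split; apply: eq_bigr => z _ /=.
  by rewrite (linearP (RF_coord z)) scalerDl scalerA.
- rewrite mulr0 mul0r RF_class0 big1 // => z _.
  by rewrite (linear0 (RF_coord z)) scale0r.
rewrite vertex_path; have [Ev|_] := eqVneq; last first.
  rewrite mul0r RF_class0 big1 // => z _.
  by rewrite (linear0 (RF_coord z)) scale0r.
rewrite path_vertex; have [Ew|_] := eqVneq; last first.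
  rewrite RF_class0 big1 // => z _.
  by rewrite (linear0 (RF_coord z)) scale0r.
subst v w; case: p => -[v ws] H; rewrite {1}cls_path_expand.
by apply: eq_bigr => z _; rewrite RF_coordE path_functionalE.
Qed.

(** The image of the [d]-th power of the arrow ideal, spanned by the classes of paths with at least
    [d] arrows. *)
Definition RF_rad d := lspan (fun r : RF =>
  exists2 p : qpath Q, (d <= size (val p).2)%N & r = cls (path p)).

Lemma RF_radM d e x y : RF_rad d x -> RF_rad e y -> RF_rad (d + e) (x * y).
Proof.
apply: lspanM => _ _ [p dp ->] [q eq ->]; rewrite -RF_classM pa_pathM /path_mul.
have := path_compP p q; case: eqP => [_ [r -> Er]|_ ->]; last first.
  by rewrite RF_class0; constructor.
by apply: lspan_gen; exists r => //; rewrite Er size_cat leq_add.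
Qed.

Lemma RF_rad_all x : RF_rad 0 x.
Proof.
have [y <-] := RF_class_surj x; elim/pa_ind: y => [a y y' Hy Hy'||p].
- by rewrite RF_class_linear; apply: lspanD Hy'; exact: lspanZ.
- by rewrite RF_class0; constructor.
- by apply: lspan_gen; exists p.
Qed.

Lemma RF_rad_nil x : RF_rad 4 x -> x = 0.
Proof.
elim=> // a _ y [p p4 ->] _ ->.
by rewrite cls_path_long // scaler0 addr0.
Qed.

(** In an expansion into paths, trivial paths contribute the scalar, which requires [v = w], and all
    other paths lie in the radical. *)
Lemma RF_rad_local (v w : vertex Q) x : exists a j, RF_rad 1 j /\
  e_ v * x * e_ w = (if v == w then a *: e_ v else 0) + j.
Proof.
elim: (RF_rad_all x) => [|b _ y [p _ ->] _ [a [j [Jj E]]]].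
  exists 0, 0; split; first by constructor.
  by rewrite mulr0 mul0r scale0r if_same addr0.
rewrite mulrDr mulrDl E -scalerAr -scalerAl -!RF_classM vertex_path.
have [Ev|_] := eqVneq v; last first.
  by rewrite mul0r RF_class0 scaler0 add0r; exists a, j.
rewrite path_vertex; have [Ew|_] := eqVneq _ w; last first.
  by rewrite RF_class0 scaler0 add0r; exists a, j.
have [|p0] := posnP (size (val p).2).
  move=> /size0nil p0.
  have Ep : p = path_nil v by apply: qpath_ext; rewrite ?p0.
  have vw : v = w by rewrite -Ew Ep.
  exists (b + a), j; split; first exact: Jj.
  have -> : (v == w) = true by apply/eqP.
  rewrite Ep.
  rewrite scalerDl.
  rewrite -addrA.
  reflexivity.
exists a, (b *: cls (path p) + j); split; last exact: addrCA.
by apply: lspanD Jj; apply/lspanZ/lspan_gen; exists p.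
Qed.

(** Built transparently, so that [ind] reduces to [RF_index] when the basis elements are finally
    counted. *)
Definition RF_basic : basic_algebra RF bool.
Proof.
apply: (@BasicAlgebra K RF bool (fun v => e_ v) _ _ RF_rad _ _ RF_radM
  RF_rad_all _ RF_rad_local RF_index (fun v w z => cls (RF_elt z)) _
  (fun v w z => RF_coord z) _ RF_elt_coord).
- move=> v w; rewrite -RF_classM vertex_path [ptgt _]/=.
  by case: eqP => [->|_] //; rewrite RF_class0.
- by rewrite -linear_sum -RF_class1.
- by constructor.
- by move=> d x y; exact: lspanD.
- by exists 4; exact: RF_rad_nil.
- by move=> v w z; rewrite -!RF_classM RF_elt_idm.
- by move=> v w z z'; exact: RF_coord_elt.
Defined.
End RFBasis.

(** * Projective modules over a basic algebra *)

Definition ract (R : nzRingType) (M : rmodType R) (x : M) (r : R) : M :=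
  (r : R^c) *: x.
Local Notation "x <| r" := (ract x r) (at level 40, left associativity).

Section RightAction.
Variables (R : nzRingType) (M : rmodType R).
Implicit Types (x y : M) (r s : R).

Lemma ractM x r s : x <| r <| s = x <| (r * s).
Proof. exact: scalerA. Qed.
Lemma ract1 x : x <| 1 = x.
Proof. exact: scale1r. Qed.
Lemma ract0 x : x <| 0 = 0.
Proof. exact: scale0r. Qed.
Lemma ract0l r : (0 : M) <| r = 0.
Proof. exact: scaler0. Qed.
Lemma ractDr x r s : x <| (r + s) = x <| r + x <| s.
Proof. exact: scalerDl. Qed.
Lemma ractDl x y r : (x + y) <| r = x <| r + y <| r.
Proof. exact: scalerDr. Qed.
Lemma ractNr x r : x <| (- r) = - (x <| r).
Proof. exact: scaleNr. Qed.
Lemma ractNl x r : (- x) <| r = - (x <| r).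
Proof. exact: scalerN. Qed.
Lemma ract_suml (I : Type) (s : seq I) (P : pred I) (F : I -> M) r :
  (\sum_(i <- s | P i) F i) <| r = \sum_(i <- s | P i) (F i <| r).
Proof. exact: scaler_sumr. Qed.
Lemma ract_sumr (I : Type) (s : seq I) (P : pred I) (F : I -> R) x :
  x <| (\sum_(i <- s | P i) F i) = \sum_(i <- s | P i) (x <| F i).
Proof. exact: scaler_suml. Qed.
Lemma linear_ract (N : rmodType R) (f : {linear M -> N}) x r :
  f (x <| r) = f x <| r.
Proof. exact: linearZ. Qed.
End RightAction.

Section ModuleBasis.
Variables (K : fieldType) (R : algType K) (T : finType).
Variable B : basic_algebra R T.

(* [P] is the direct sum of the right ideals [idm (mb_vertex s) * R]. *)
Record module_basis (P : rmodType R) := ModuleBasis {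
  mb_size : nat;
  mb_vertex : 'I_mb_size -> T;
  mb_elt : 'I_mb_size -> P;
  mb_coo : 'I_mb_size -> P -> R;
  mb_eltE : forall s, mb_elt s <| idm B (mb_vertex s) = mb_elt s;
  mb_cooE : forall s x, idm B (mb_vertex s) * mb_coo s x = mb_coo s x;
  mb_cooD : forall s x y, mb_coo s (x + y) = mb_coo s x + mb_coo s y;
  mb_coo_ract : forall s x r, mb_coo s (x <| r) = mb_coo s x * r;
  mb_expand : forall x, x = \sum_s mb_elt s <| mb_coo s x;
  mb_dual : forall s t, mb_coo t (mb_elt s) =
    if s == t then idm B (mb_vertex s) else 0 }.

Lemma radZ d a x : rad B d x -> rad B d (a *: x).
Proof.
move=> Jx; have := radM (rad_all B a%:A) Jx.
by rewrite add0n -scalerAl mul1r.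
Qed.

Lemma radX x d : rad B 1 x -> rad B d (x ^+ d).
Proof.
move=> Jx; elim: d => [|d IH]; first exact: rad_all.
by rewrite exprS; exact: (radM Jx IH).
Qed.

Lemma rad_sum (I : Type) (s : seq I) (F : I -> R) d :
  (forall i, rad B d (F i)) -> rad B d (\sum_(i <- s) F i).
Proof.
move=> H; elim: s => [|i s IH]; first by rewrite big_nil; exact: rad0.
by rewrite big_cons; exact: radD.
Qed.

Section Minimal.
Variable P : rmodType R.

Definition vertex_generated (N : nat) : Prop :=
  exists (v : 'I_N -> T) (q : 'I_N -> P),
    (forall s, q s <| idm B (v s) = q s) /\
    forall x, exists r : 'I_N -> R, x = \sum_s q s <| r s.

(** The idempotents sum to 1, so each generator splits into its pieces [g i <| idm B w]. *)
Lemma fg_vertex_generated :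
  finitely_generated P -> exists N, vertex_generated N.
Proof.
case=> l [g Hg]; pose J : finType := ('I_l * T)%type.
exists #|J|, (fun s => (enum_val s).2),
  (fun s => g (enum_val s).1 <| idm B (enum_val s).2).
split=> [s|x]; first by rewrite ractM idmM eqxx.
have [r ->] := Hg x; exists (fun s => r (enum_val s).1).
transitivity (\sum_(p : J) g p.1 <| idm B p.2 <| r p.1).
  rewrite -(pair_bigA _ (fun i w => g i <| idm B w <| r i)) /=.
  apply: eq_bigr => i _; rewrite -ract_suml -ract_sumr idm_sum.
  by rewrite ract1.
by rewrite (reindex _ (onW_bij _ (enum_val_bij J))).
Qed.

(* If [r s] were not in the radical, [q s] would equal [q s * u] modulo the other
   generators for a nilpotent [u], and could be dropped. *)
Lemma minimal_relation_rad N (v : 'I_N -> T) (q : 'I_N -> P) :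
  (forall s, q s <| idm B (v s) = q s) ->
  (forall x, exists r : 'I_N -> R, x = \sum_s q s <| r s) ->
  (forall N', vertex_generated N' -> (N <= N')%N) ->
  forall r : 'I_N -> R, \sum_s q s <| r s = 0 ->
  (forall s, idm B (v s) * r s = r s) -> forall s, rad B 1 (r s).
Proof.
move=> qe gen minN r rel er s.
have [a [j [Jj Ea]]] := rad_local B (v s) (v s) (r s).
rewrite eqxx er in Ea.
(* If the scalar part at [v s] vanishes, every piece [r s * idm B w] lies in the radical, since
   [rad_local] allows no scalar for [w] different from [v s]. *)
have [a0|a0] := eqVneq a 0.
  rewrite -[r s]mulr1 -(idm_sum B) mulr_sumr; apply: rad_sum => w.
  have [a' [j' [Jj' Ea']]] := rad_local B (v s) w (r s); rewrite er in Ea'.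
  have [vw|vw] := eqVneq (v s) w; last by rewrite Ea' (negPf vw) add0r.
  by rewrite -vw Ea a0 scale0r add0r.
case: N v q qe gen minN r rel er s j Jj Ea => [|N] v q qe gen minN r rel er s;
  first by case: s.
move=> j Jj Ea.
pose L (x : P) := exists c : 'I_N -> R, x = \sum_t q (lift s t) <| c t.
have LD x y : L x -> L y -> L (x + y).
  move=> [c ->] [d ->]; exists (fun t => c t + d t); rewrite -big_split.
  by apply: eq_bigr => t _; rewrite ractDr.
have LM x b : L x -> L (x <| b).
  move=> [c ->]; exists (fun t => c t * b); rewrite ract_suml.
  by apply: eq_bigr => t _; rewrite ractM.
pose u := - (a^-1 *: j).
(* The relation expresses [q s <| r s] through the other generators; divide by the scalar part [a]
   of [r s]. *)
have Lu : L (q s - q s <| u).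
  have -> : q s - q s <| u =
      q s <| (r s * idm B (v s)) <| (a^-1)%:A.
    rewrite Ea ractDr ractDl !ractM -scalerAl -!scalerAr mulr1 scalerA.
    by rewrite mulfV // scale1r mulr1 qe /u ractNr opprK.
  apply: (LM); rewrite -ractM; apply: LM.
  exists (fun t => - r (lift s t)).
  move: rel; rewrite (bigD1_ord s) //= => /(canRL (addrK _)).
  rewrite sub0r => ->; rewrite -sumrN.
  by apply: eq_bigr => t _; rewrite ractNr.
(* A telescoping argument; nilpotency of [u] then puts [q s] itself into [L]. *)
have Lud d : L (q s - q s <| u ^+ d).
  elim: d => [|d IH].
    exists (fun=> 0); rewrite expr0 ract1 subrr big1 // => t _; exact: ract0.
  have -> : q s - q s <| u ^+ d.+1 =
      (q s - q s <| u) + (q s - q s <| u ^+ d) <| u.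
    by rewrite ractDl ractNl ractM -exprSr addrA subrK.
  by apply: LD => //; exact: LM.
have [d nild] := rad_nil B.
have [c qc] : L (q s).
  have := Lud d; rewrite [u ^+ d]nild ?ract0 ?subr0 //; apply: radX.
  by rewrite /u -scaleN1r; do 2!apply: radZ.
have : vertex_generated N.
  exists (v \o lift s), (q \o lift s); split=> [t|x]; first exact: qe.
  have [b ->] := gen x; exists (fun t => c t * b s + b (lift s t)).
  rewrite (bigD1_ord s) //= {1}qc ract_suml -big_split.
  by apply: eq_bigr => t _; rewrite /= ractDr ractM.
by move/minN; rewrite ltnn.
Qed.

(** Take a generating family of minimal size. Projectivity splits the surjection from a free module
    onto [P], which provides coordinates, and minimality makes these dual to the generators. *)
Lemma projective_basis : projective P -> finitely_generated P ->
  exists b : module_basis P, True.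
Proof.
move=> projP /fg_vertex_generated fgP.
have exN : exists N, `[< vertex_generated N >].
  by have [N HN] := fgP; exists N; apply/asboolP.
case: (ex_minnP exN) => N /asboolP[v [q [qe gen]]] minN.
have {}minN N' : vertex_generated N' -> (N <= N')%N by move/asboolP/minN.
pose F : rmodType R := {ffun 'I_N -> (R^c)^o}.
pose g (f : F) : P := \sum_s q s <| (f s : R).
have glin : linear g.
  move=> a x y; rewrite /g scaler_sumr -big_split; apply: eq_bigr => s _ /=.
  by rewrite !ffunE ractDr; congr (_ + _); exact/esym/scalerA.
pose gL : {linear F -> P} := HB.pack g (GRing.isLinear.Build _ _ _ _ g glin).
have [|h hK] := projP F P gL idfun.
  move=> y; have [r ->] := gen y; exists [ffun s => r s].
  by apply: eq_bigr => s _; rewrite ffunE.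
pose c s x : R := idm B (v s) * (h x s : R).
have expand x : x = \sum_s q s <| c s x.
  by rewrite -[LHS](hK x); apply: eq_bigr => s _; rewrite /c -ractM qe.
have cD s x y : c s (x + y) = c s x + c s y.
  by rewrite /c linearD ffunE mulrDr.
have cM s x r : c s (x <| r) = c s x * r.
  by rewrite /c linear_ract ffunE mulrA.
have ec s x : idm B (v s) * c s x = c s x by rewrite /c mulrA idmM eqxx.
have c0 s : c s 0 = 0 by rewrite -(ract0 (0 : P)) cM mulr0.
have csum s (I : finType) (G : I -> P) : c s (\sum_i G i) = \sum_i c s (G i).
  by exact: (big_morph (c s) (cD s) (c0 s)).
pose e s := idm B (v s).
(* The deviation from duality; each row of [k] is a relation between the generators, so its entries
   lie in the radical. *)
pose k s t := (if s == t then e s else 0) - c t (q s).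
have krel s : \sum_t q t <| k s t = 0.
  rewrite (eq_bigr (fun t =>
    (if s == t then q t <| e s else 0) - q t <| c t (q s))) => [|t _].
    by rewrite sumrB -expand -big_mkcond (big_pred1 s) /= ?qe ?subrr.
  by rewrite /k ractDr ractNr; case: eqP; rewrite ?ract0.
have ek s t : e t * k s t = k s t.
  rewrite /k mulrBr ec; case: eqP => [->|_]; last by rewrite mulr0.
  by rewrite /e idmM eqxx.
(* The matrix [k] is idempotent with entries in the radical, hence zero. *)
have kk s t : k s t = \sum_u k u t * k s u.
  have /(congr1 (c t)) := krel s; rewrite csum c0 => E.
  rewrite (eq_bigr (fun u => (if u == t then e u * k s u else 0)
    - c t (q u <| k s u))) => [|u _].
    by rewrite sumrB E subr0 -big_mkcond big_pred1_eq ek.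
  by rewrite cM {1}/k mulrBl; case: eqP; rewrite ?mul0r.
have krad s t d : rad B d (k s t).
  elim: d s t => [|d IH] s t; first exact: rad_all.
  rewrite kk; apply: rad_sum => u; rewrite -addn1 addnC.
  apply: radM => //.
  exact: (minimal_relation_rad qe gen minN (krel u) (ek u)).
have [d nild] := rad_nil B.
have k0 s t : k s t = 0 by apply: nild; exact: krad.
unshelve eexists (@ModuleBasis P N v q c qe ec cD cM expand _) => //.
by move=> s t; apply/esym/subr0_eq; exact: k0.
Qed.
End Minimal.
End ModuleBasis.

(** * Graded endomorphisms of a perfect complex *)

Definition intodd (i : int) : bool := odd `|i|%N.

Lemma intoddD i j : intodd (i + j) = intodd i (+) intodd j.
Proof. rewrite /intodd; lia. Qed.

Section DegreeCast.
Variables (R : nzRingType) (E : complex R).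

(* Transport along an equality of degrees, made total (zero when [i <> j]). *)
Definition dcast (i j : int) (x : E i) : E j :=
  if i =P j is ReflectT e then eq_rect i (fun l => E l : Type) x j e else 0.

Lemma dcast_id i (x : E i) : dcast i x = x.
Proof. by rewrite /dcast; case: eqP => // e; rewrite eq_axiomK. Qed.

Lemma dcast_neq i j (x : E i) : i != j -> dcast j x = 0.
Proof. by rewrite /dcast; case: eqP => // ->; rewrite eqxx. Qed.

Lemma dcast_linear i j : linear (@dcast i j).
Proof.
move=> r x y; have [e|ne] := eqVneq i j; first by subst j; rewrite !dcast_id.
by rewrite !dcast_neq // scaler0 addr0.
Qed.

HB.instance Definition _ i j :=
  GRing.isLinear.Build R^c (E i) (E j) _ (@dcast i j) (@dcast_linear i j).

Lemma cdiff_dcast i j l (x : E i) :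
  i = j -> cdiff E j l (dcast j x) = cdiff E i l x.
Proof. by move=> e; subst j; rewrite dcast_id. Qed.
End DegreeCast.

Section ComplexBasis.
Variables (K : fieldType) (R : algType K) (T : finType) (B : basic_algebra R T).
Local Notation e_ := (idm B).

(** One finite index set serves all degrees: elements and coordinates are defined in every degree
    and vanish outside [cb_deg s], so sums over indices of different degrees make sense. *)
Record complex_basis (E : complex R) := ComplexBasis {
  cb_index : finType;
  cb_deg : cb_index -> int;
  cb_vertex : cb_index -> T;
  cb_elt : forall i, cb_index -> E i;
  cb_coo : forall i, cb_index -> E i -> R;
  cb_eltE : forall i s, cb_elt i s <| e_ (cb_vertex s) = cb_elt i s;
  cb_cooE : forall i s x, e_ (cb_vertex s) * @cb_coo i s x = cb_coo s x;
  cb_cooD : forall i s x y, @cb_coo i s (x + y) = cb_coo s x + cb_coo s y;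
  cb_coo_ract : forall i s x r, @cb_coo i s (x <| r) = cb_coo s x * r;
  cb_expand : forall i x, x = \sum_s cb_elt i s <| cb_coo s x;
  cb_dual : forall i s t, cb_coo t (cb_elt i s) =
    if (s == t) && (cb_deg s == i) then e_ (cb_vertex s) else 0;
  cb_elt_deg : forall i s, cb_deg s != i -> cb_elt i s = 0;
  cb_coo_deg : forall i s x, cb_deg s != i -> @cb_coo i s x = 0 }.

Lemma perf_basis (E : perf R) : exists b : complex_basis E, True.
Proof.
have [a [b bd]] := perf_bounded E.
pose M i :=
  sval (cid (projective_basis B (@perf_proj _ _ E i) (@perf_fg _ _ E i))).
(* The degrees [a, a + 1, ...] listed here cover the interval from [a] to [b], outside of which [E]
   is zero. *)
pose S : finType := {i : 'I_`|b - a|.+1 & 'I_(mb_size (M (a + i)))}.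
pose dg (s : S) : int := a + tag s.
pose q (s : S) : E (dg s) := @mb_elt _ _ _ _ _ (M _) (tagged s).
pose co (s : S) (x : E (dg s)) : R := @mb_coo _ _ _ _ _ (M _) (tagged s) x.
pose vx (s : S) := @mb_vertex _ _ _ _ _ (M _) (tagged s).
have co0 (s : S) : co s 0 = 0.
  by rewrite -(ract0 (0 : E (dg s))) /co mb_coo_ract mulr0.
unshelve eexists (@ComplexBasis E S dg vx (fun i s => dcast i (q s))
  (fun i s x => co s (dcast (dg s) x)) _ _ _ _ _ _ _ _) => //.
- by move=> i s; rewrite -linear_ract mb_eltE.
- by move=> i s x; exact: mb_cooE.
- by move=> i s x y; rewrite /= linearD; exact: mb_cooD.
- by move=> i s x r; rewrite /= linear_ract; exact: mb_coo_ract.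
- move=> i x; have [ab|nab] := boolP ((a <= i) && (i <= b)); last first.
    rewrite big1 => [|s _].
      by apply: bd; move: nab; rewrite negb_and -!ltNge.
    by rewrite [dcast i _]bd ?ract0l //; move: nab; rewrite negb_and -!ltNge.
  have i0lt : (`|i - a| < `|b - a|.+1)%N by lia.
  have [i0 Ei] : exists i0 : 'I_`|b - a|.+1, i = a + i0.
    by exists (Ordinal i0lt); rewrite /=; lia.
  clear i0lt.
  subst i; pose F (s : S) := dcast (a + i0) (q s) <| co s (dcast (dg s) x).
  pose N (l : 'I_`|b - a|.+1) := mb_size (M (a + l)).
  transitivity (\sum_l \sum_(t < N l) F (Tagged (fun l => 'I_(N l)) t)).
    rewrite (bigD1 i0) //= [X in _ = _ + X]big1 ?addr0 => [|l Nl]; last first.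
      rewrite big1 // => t _; rewrite /F dcast_neq ?ract0l //.
      by apply: contra Nl => /eqP/addrI[/val_inj->].
    rewrite [LHS](mb_expand (M (a + i0))); apply: eq_bigr => t _.
    by rewrite /F !dcast_id.
  by rewrite sig_big_dep; apply: eq_bigr => -[].
- move=> i s t; have [Ei|Ni] := eqVneq (dg s) i; last first.
    by rewrite andbF (dcast_neq (q s) Ni) linear0 co0.
  subst i; rewrite andbT dcast_id.
  case: s t => [l j] [l' j']; have [El|Nl] := eqVneq l l'.
    subst l'; rewrite dcast_id eq_Tagged /=; exact: mb_dual.
  rewrite dcast_neq ?co0.
    by case: eqP => // -[/eqP]; rewrite (negPf Nl).
  by apply: contra Nl => /eqP/addrI[/val_inj->].
- by move=> i s Ni; exact: dcast_neq.
- by move=> i s x Ni; rewrite /= dcast_neq ?co0 // eq_sym.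
Qed.
End ComplexBasis.

Definition sgn (A : zmodType) (e : bool) (x : A) : A := if e then - x else x.

Lemma ract_scalarC (K : fieldType) (R : algType K) (M : rmodType R) (x : M)
    r a :
  x <| r <| a%:A = x <| a%:A <| r.
Proof. by rewrite !ractM mulr_algr mulr_algl. Qed.

Lemma sgn0 (A : zmodType) e : sgn e (0 : A) = 0.
Proof. by case: e; rewrite /sgn ?oppr0. Qed.

Lemma sgnD (A : zmodType) e (x y : A) : sgn e (x + y) = sgn e x + sgn e y.
Proof. by case: e; rewrite /sgn ?opprD. Qed.

Lemma sgn_ract (R : nzRingType) (M : rmodType R) e (x : M) r :
  sgn e (x <| r) = sgn e x <| r.
Proof. by case: e; rewrite /sgn ?ractNl. Qed.

(** * Finite-dimensional coordinates for graded endomorphisms *)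

Section GradedMaps.
Variables (K : fieldType) (R : algType K) (T : finType) (B : basic_algebra R T).
Variables (E : complex R) (b : complex_basis B E).
Local Notation e_ := (idm B).
Local Notation S := (cb_index b).
Local Notation dg := (@cb_deg _ _ _ _ _ b).
Local Notation vx := (@cb_vertex _ _ _ _ _ b).
Local Notation qq := (@cb_elt _ _ _ _ _ b).
Local Notation cc i := (@cb_coo _ _ _ _ _ b i).

(** Components of every degree [j - i] are kept together; later only the parity of the degree is
    distinguished. *)
Definition gmap := forall i j : int, E i -> E j.
Implicit Types (f g : gmap).

Definition glinear f := forall i j, linear (f i j).

(* The graded commutator with the differential; [e] is the parity of [f]. *)
Definition gdiff (e : bool) f : gmap := fun i j x =>
  cdiff E (j - 1) j (f i (j - 1) x) - sgn e (f (i + 1) j (cdiff E i (i + 1) x)).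
Arguments gdiff e f i j x : clear implicits.

Lemma glinear_ract f i j x r : glinear f -> f i j (x <| r) = f i j x <| r.
Proof.
move=> fL; have f0 : f i j 0 = 0.
  by have := fL i j (-1) 0 0; rewrite scaler0 addr0 scaleN1r addNr.
by have := fL i j r x 0; rewrite f0 !addr0.
Qed.

Lemma glinear0 f i j : glinear f -> f i j 0 = 0.
Proof. by move=> fL; have := @glinear_ract f i j 0 0 fL; rewrite !ract0. Qed.

Lemma glinearD f i j x y : glinear f -> f i j (x + y) = f i j x + f i j y.
Proof. by move=> fL; have := fL i j 1 x y; rewrite !scale1r. Qed.

Lemma glinear_sum f i j (I : Type) (s : seq I) (F : I -> E i) : glinear f ->
  f i j (\sum_(t <- s) F t) = \sum_(t <- s) f i j (F t).
Proof.
move=> fL; apply: (big_morph (f i j)) => [x y|]; first exact: glinearD.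
exact: glinear0.
Qed.

Lemma sgn_linear (A : lmodType R^c) e : linear (@sgn A e).
Proof. by case: e => r x y //=; rewrite /sgn opprD scalerN. Qed.

Lemma gdiff_linear e f : glinear f -> glinear (gdiff e f).
Proof.
move=> fL i j r x y; rewrite /gdiff linearP fL linearP fL sgn_linear.
by rewrite scalerBr opprD addrACA.
Qed.

Lemma gdiffK e f i j x : glinear f -> gdiff (~~ e) (gdiff e f) i j x = 0.
Proof.
move=> fL; rewrite /gdiff !cdiffK linearB cdiffK sub0r (glinear0 _ _ fL).
rewrite sgn0.
by case: e; rewrite /sgn /= ?linearN ?opprK ?subr0 ?addNr ?subrr //.
Qed.

(** Matrix units: a pair consists of a target and a source summand, and a module map between these
    is left multiplication by an element of [idm v * R * idm w]. *)
Definition gindex : finType := {p : S * S & ind B (vx p.1) (vx p.2)}.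
Definition gparity (k : gindex) : bool :=
  intodd (dg (tag k).2) (+) intodd (dg (tag k).1).
Definition gpart (e : bool) : finType := {k : gindex | gparity k == e}.

Definition gunit (k : gindex) : gmap := fun i j x =>
  qq j (tag k).1 <| (elt (tagged k) * cc i (tag k).2 x).
Arguments gunit k i j x : clear implicits.

Definition gcoord f (k : gindex) : K :=
  coo (tagged k)
    (cc (dg (tag k).1) (tag k).1 (f _ _ (qq (dg (tag k).2) (tag k).2)) : R).
Arguments gcoord f k : clear implicits.

Definition gemb e (x : {ffun gpart e -> K^o}) : gmap := fun i j z =>
  \sum_k gunit (val k) i j z <| (x k : K)%:A.
Arguments gemb e x i j z : clear implicits.

Definition gco e f : {ffun gpart e -> K^o} := [ffun k => gcoord f (val k)].
Arguments gco e f : clear implicits.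

Lemma cc0 i s : cc i s 0 = 0.
Proof. by rewrite -(ract0 (0 : E i)) cb_coo_ract mulr0. Qed.

Lemma cc_sum i s (I : Type) (r : seq I) (F : I -> E i) :
  cc i s (\sum_(t <- r) F t) = \sum_(t <- r) cc i s (F t).
Proof. by apply: (big_morph (cc i s)); [exact: cb_cooD|exact: cc0]. Qed.

Lemma gunit_linear k : glinear (gunit k).
Proof.
move=> i j r x y; rewrite /gunit -/(ract x r) cb_cooD cb_coo_ract.
by rewrite mulrDr ractDr mulrA -ractM.
Qed.

Lemma gemb_linear e x : glinear (gemb e x).
Proof.
move=> i j r y z; rewrite /gemb scaler_sumr -big_split.
apply: eq_bigr => k _ /=.
by rewrite gunit_linear ractDl; congr (_ + _); exact: ract_scalarC.
Qed.

Lemma gcoord_gunit k k' : gcoord (gunit k') k = (k == k')%:R.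
Proof.
case: k k' => -[t s] z [[t' s'] z']; rewrite /gcoord /gunit /=.
rewrite cb_coo_ract cb_dual; have [Et|Nt] := eqVneq t' t; last first.
  rewrite mul0r linear0; case: eqP => // E0; case/eqP: Nt.
  by case: (congr1 (fun k : gindex => (tag k).1) E0).
rewrite cb_dual; have [Es|Ns] := eqVneq s s'; last first.
  rewrite !mulr0 linear0; case: eqP => // E0; case/eqP: Ns.
  by case: (congr1 (fun k : gindex => (tag k).2) E0).
subst t' s'; rewrite !eqxx /= mulrA elt_idm coo_elt eq_Tagged.
by rewrite eq_sym.
Qed.

Lemma gco_gemb e x : gco e (gemb e x) = x.
Proof.
apply/ffunP => k; rewrite ffunE /gcoord /gemb cc_sum linear_sum (bigD1 k) //=.
rewrite cb_coo_ract mulr_algr linearZ /=.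
have /= := gcoord_gunit (val k) (val k); rewrite /gcoord eqxx => ->.
rewrite big1 => [|k' Nk]; first by rewrite addr0; exact: mulr1.
rewrite cb_coo_ract mulr_algr linearZ /=.
have /= := gcoord_gunit (val k) (val k'); rewrite /gcoord => ->.
have -> : (val k == val k') = false.
  by apply: contraNF Nk => /eqP/val_inj->.
exact: mulr0.
Qed.

(** A linear map is recovered from its matrix in the basis of [E]. Restricting to matrix units of
    parity [e] keeps exactly the components of that parity. *)
Lemma gemb_gco e f i j x : glinear f ->
  gemb e (gco e f) i j x = if intodd i (+) intodd j == e then f i j x else 0.
Proof.
move=> fL; rewrite /gemb.
pose F (k : gindex) := gunit k i j x <| (gcoord f k)%:A.
rewrite (eq_bigr (fun k => F (val k))) => [|k _]; last by rewrite ffunE.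
rewrite -(big_sub [pred k : gindex | gparity k == e] F) /=.
pose G (k : gindex) := if gparity k == e then F k else 0.
have GE (p : S * S) : \sum_(z : ind B (vx p.1) (vx p.2))
    G (Tagged (fun p : S * S => ind B (vx p.1) (vx p.2)) z) =
    if intodd i (+) intodd j == e
    then qq j p.1 <| (cc j p.1 (f i j (qq i p.2)) * cc i p.2 x) else 0.
  case: p => t s; rewrite /= /G /F /gunit /gparity /gcoord /=.
  have [Et|Nt] := eqVneq (dg t) j; last first.
    rewrite (cb_elt_deg Nt) ract0l if_same big1 // => z _.
    by rewrite !ract0l if_same.
  have [Es|Ns] := eqVneq (dg s) i; last first.
    rewrite (cb_coo_deg _ Ns) mulr0 ract0 if_same big1 // => z _.
    by rewrite mulr0 ract0 ract0l if_same.
  subst i j; case: eqP => // _; last by rewrite big1.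
  set m := cc (dg t) t _.
  (* The matrix entry is fixed by the idempotents of its row and column, so it expands in the chosen
     basis of that corner of [R]. *)
  have Em : e_ (vx t) * m * e_ (vx s) = m.
    by rewrite /m cb_cooE -cb_coo_ract -glinear_ract // cb_eltE.
  rewrite -[in RHS]Em (elt_coo B) mulr_suml ract_sumr.
  by apply: eq_bigr => z _; rewrite ractM Em mulr_algr scalerAl.
transitivity (\sum_(p : S * S) \sum_(z : ind B (vx p.1) (vx p.2))
    G (Tagged (fun p : S * S => ind B (vx p.1) (vx p.2)) z)).
  by rewrite sig_big_dep big_mkcond; apply: eq_bigr => -[].
rewrite (eq_bigr _ (fun p _ => GE p)); case: eqP => _; last by rewrite big1.
rewrite -(pair_bigA _
  (fun t s => qq j t <| (cc j t (f i j (qq i s)) * cc i s x))).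
rewrite exchange_big /= [in RHS](cb_expand b x) glinear_sum //.
apply: eq_bigr => s _; rewrite glinear_ract //.
rewrite [in RHS](cb_expand b (f i j (qq i s))) ract_suml.
by apply: eq_bigr => t _; rewrite ractM.
Qed.

Lemma gemb_off e x i j z : intodd i (+) intodd j != e -> gemb e x i j z = 0.
Proof.
move=> N; rewrite -(gco_gemb x) gemb_gco ?(negPf N) //; exact: gemb_linear.
Qed.

Lemma gco_eq e f g :
  (forall i j x, intodd i (+) intodd j = e -> f i j x = g i j x) ->
  gco e f = gco e g.
Proof.
move=> fg; apply/ffunP => k; rewrite !ffunE /gcoord fg //.
exact/eqP/(valP k).
Qed.

Lemma gco_linear e f g a :
  gco e (fun i j x => f i j x <| a%:A + g i j x) = a *: gco e f + gco e g.
Proof.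
apply/ffunP => k; rewrite !ffunE /gcoord cb_cooD cb_coo_ract mulr_algr.
by rewrite linearP.
Qed.

Definition gdiff_coord e (x : {ffun gpart e -> K^o}) :
    {ffun gpart (~~ e) -> K^o} :=
  gco (~~ e) (gdiff e (gemb e x)).

Lemma gdiff_coord_linear e : linear (@gdiff_coord e).
Proof.
move=> a x y; rewrite /gdiff_coord -gco_linear; apply: gco_eq => i j z _.
have El l l' u : gemb e (a *: x + y) l l' u =
    gemb e x l l' u <| a%:A + gemb e y l l' u.
  rewrite /gemb ract_suml -big_split; apply: eq_bigr => k _ /=.
  rewrite !ffunE ractM -ractDr; congr (_ <| _).
  by rewrite mulr_algr scalerA -scalerDl.
rewrite /gdiff !El linearD linear_ract ractDl ractNl addrACA; congr (_ + _).
rewrite -opprD; congr (- _).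
by rewrite sgnD sgn_ract.
Qed.
HB.instance Definition _ e :=
  GRing.isLinear.Build K _ _ _ _ (@gdiff_coord_linear e).

(** Nothing is lost in coordinates, because [gdiff] reverses the parity of the components. *)
Lemma gemb_gdiff_coord e x i j z :
  gemb (~~ e) (gdiff_coord x) i j z = gdiff e (gemb e x) i j z.
Proof.
rewrite gemb_gco; last exact/gdiff_linear/gemb_linear.
case: eqP => // /eqP N; rewrite /gdiff !gemb_off ?linear0 ?sgn0 ?subrr.
- by [].
- apply: contra N => /eqP <-; rewrite intoddD.
  by case: (intodd i) (intodd j) => [] [].
- apply: contra N => /eqP <-; rewrite intoddD.
  by case: (intodd i) (intodd j) => [] [].
Qed.

Lemma gdiff_coordK e x : @gdiff_coord (~~ e) (gdiff_coord x) = 0.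
Proof.
apply/ffunP => k; rewrite !ffunE /gcoord.
have -> i j z : gdiff (~~ e) (gemb (~~ e) (gdiff_coord x)) i j z = 0.
  have <- := @gdiffK e (gemb e x) i j z (gemb_linear x).
  by rewrite /gdiff !gemb_gdiff_coord.
by rewrite cc0 linear0.
Qed.
End GradedMaps.
Arguments gdiff {K R E} e f i j x.
Arguments gemb {K R T B E b} e x i j z.

(** * The Euler characteristic of an exceptional object *)

Lemma sgn_raddf (A C : zmodType) (f : {additive A -> C}) e x :
  f (sgn e x) = sgn e (f x).
Proof. by case: e; rewrite /sgn ?raddfN. Qed.

Lemma sgnK (A : zmodType) e (x : A) : - sgn (~~ e) (sgn e x) = x.
Proof. by case: e; rewrite /sgn ?opprK. Qed.

(** * Null-homotopies obtained from exceptionality *)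

Section Homotopies.
Variables (K : fieldType) (R : algType K).

Lemma kscale_sgn (M : rmodType R) p (y : M) :
  kscale ((- 1 : K) ^+ `|p|%N) y = sgn (intodd p) y.
Proof.
rewrite -signr_odd -/(intodd p); case: (intodd p); rewrite /sgn /kscale.
  by rewrite expr1 !scaleN1r.
by rewrite expr0 !scale1r.
Qed.

Lemma quot_chain_null (E F : complex R) (f : chain_map E F) :
  quot_class (@null_pred K R E F) f = 0 -> null_homotopic f.
Proof.
move=> E0; have /quot_classP : quot_class (@null_pred K R E F) f =
  quot_class (@null_pred K R E F) 0 by rewrite E0 linear0.
by rewrite subr0 => /asboolP.
Qed.

Section Assemble.
Variable E : complex R.
Implicit Types f G : gmap E.

Lemma homotopy_assemble e G :
  (forall p, intodd p = e -> exists h : forall i j, {linear E i -> E (j + p)},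
    forall i x, G i (i + p) x =
      sgn e (cdiff E (i - 1 + p) (i + p) (h i (i - 1) x))
      + h (i + 1) i (cdiff E i (i + 1) x)) ->
  exists H : gmap E, glinear H /\
    forall i j x, intodd i (+) intodd j = e -> G i j x = gdiff (~~ e) H i j x.
Proof.
move=> hG; have {}hG p : exists h : forall i j, {linear E i -> E (j + p)},
    intodd p = e -> forall i x,
    G i (i + p) x = sgn e (cdiff E (i - 1 + p) (i + p) (h i (i - 1) x))
      + h (i + 1) i (cdiff E i (i + 1) x).
  have [pe|pe] := eqVneq (intodd p) e.
    by have [h Hh] := hG p pe; exists h.
  (* For the other parity the zero family is a default, so that a homotopy can be chosen for all [p]
     at once. *)
  by exists (fun i j => \0) => pe'; rewrite pe' eqxx in pe.
pose h p := sval (cid (hG p)).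
have hE p : intodd p = e -> forall i x,
    G i (i + p) x = sgn e (cdiff E (i - 1 + p) (i + p) (h p i (i - 1) x))
      + h p (i + 1) i (cdiff E i (i + 1) x).
  exact: (svalP (cid (hG p))).
(* The component from [E i] to [E j] has degree [p - 1] with [p = j - (i - 1)]; the factor [sgn e]
   converts the sign of the shifted differential to the convention of [gdiff]. *)
pose H : gmap E := fun i j x => sgn e (dcast j (h (j - (i - 1)) i (i - 1) x)).
have HE p i l j x : l = i - 1 -> l + p = j ->
    H i j x = sgn e (dcast j (h p i l x)).
  by move=> -> pj; have -> : p = j - (i - 1) by rewrite -pj; ring.
exists H; split=> [i j r x y|i j x ij].
  by rewrite /H !linearP sgn_linear.
have [p Ej] : exists p, j = i + p by exists (j - i); ring.
subst j; rewrite intoddD addKb in ij.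
rewrite /gdiff (HE p i (i - 1)) // ?(HE p (i + 1) i) //; try by ring.
rewrite sgnK dcast_id.
rewrite (sgn_raddf (cdiff E (i + p - 1) (i + p))) /= cdiff_dcast; last by ring.
exact: hE.
Qed.
End Assemble.

Variable E : perf R.
Hypothesis excE : exceptional E.

(** The degree [p] part of a closed map is a chain map from [E] to its shift by [p], and [p != 0]
    makes its homotopy class zero. *)
Lemma exceptional_shift (G : gmap E) p : p != 0 -> glinear G ->
  (forall i j x, gdiff (intodd p) G i j x = 0) ->
  exists h : forall i j, {linear E i -> E (j + p)},
    forall i x, G i (i + p) x =
      sgn (intodd p) (cdiff E (i - 1 + p) (i + p) (h i (i - 1) x))
      + h (i + 1) i (cdiff E i (i + 1) x).
Proof.
move=> p0 GL Gd.
have comm i j (x : E i) : cdiff (perf_shift E p) i j (G i (i + p) x) =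
    G j (j + p) (cdiff E i j x).
  have [->|ij] := eqVneq j (i + 1); last first.
    by rewrite !cdiff_shape // glinear0.
  rewrite [LHS]kscale_sgn; have := Gd i (i + 1 + p) x; rewrite /gdiff.
  have : i + 1 + p - 1 = i + p by ring.
  move: (i + 1 + p - 1) => l -> /subr0_eq ->.
  by case: (intodd p); rewrite /sgn ?opprK.
pose g : chain_map E (perf_shift E p) :=
  @ChainMap K R E (perf_shift E p) (fun i => G i (i + p))
    (fun i => GL i (i + p)) comm.
have := excE.2 p p0 (quot_class (@null_pred K R E (perf_shift E p)) g).
move=> /quot_chain_null[h Hh].
exists h => i x; rewrite [LHS]Hh; congr (_ + _).
exact: kscale_sgn.
Qed.

(** The generator represents the class that [phi] sends to 1, and [c] is the value of [phi] on the
    class of [g]. *)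
Lemma exceptional_generator : exists g0 : chain_map E E, ~ null_homotopic g0 /\
  forall g : chain_map E E, exists c : K, null_homotopic (g - c *: g0).
Proof.
have [[phi [psi phiK psiK]] _] := excE.
have [g0 Eg0] := quot_class_surj (psi (1 : K^o)).
have phi0 : phi (quot_class _ g0) = 1 by rewrite Eg0 psiK.
exists g0; split=> [/asboolP null|g].
  have : quot_class (@null_pred K R E E) g0 = quot_class (@null_pred K R E E) 0.
    by apply/quot_classP; rewrite subr0.
  rewrite linear0 => E0; move: phi0; rewrite E0 linear0 => /esym/eqP.
  by rewrite oner_eq0.
exists (phi (quot_class _ g)); apply: quot_chain_null.
apply: (can_inj phiK); rewrite linear0 linearB linearB linearZ linearZ /= phi0.
by apply/eqP; rewrite subr_eq0; apply/eqP/esym/mulr1.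
Qed.
End Homotopies.

Section EulerCharacteristic.
Variables (K : fieldType) (R : algType K) (T : finType) (B : basic_algebra R T).
Variables (E : perf R) (b : complex_basis B E).
Hypothesis excE : exceptional E.

Lemma chain_gmap (g0 : chain_map E E) (f : gmap E) :
  f = (fun i j x => dcast j (g0 i x)) ->
  glinear f /\ forall i j x, gdiff false f i j x = 0.
Proof.
move=> ->; split=> [i j r x y|i j x]; first by rewrite (cm_linear g0) linearP.
rewrite /gdiff /sgn; have [->|Nj] := eqVneq j (i + 1).
  by rewrite cdiff_dcast ?addrK // dcast_id (cm_comm g0) subrr.
have N1 : i + 1 != j by rewrite eq_sym.
have N2 : i != j - 1 by rewrite eq_sym subr_eq.
by rewrite !dcast_neq // linear0 subrr.
Qed.

(** The degree 0 part is a chain map, hence a multiple of [g0] up to homotopy; parts of nonzero even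
    degree are null-homotopic. Subtract the multiple and assemble. *)
Lemma closed_even_homotopic (g0 : chain_map E E) (f : gmap E) :
  (forall g : chain_map E E, exists c : K, null_homotopic (g - c *: g0)) ->
  glinear f -> (forall i j x, gdiff false f i j x = 0) ->
  exists c H, glinear H /\ forall i j x, intodd i (+) intodd j = false ->
    f i j x = dcast j (g0 i x) <| c%:A + gdiff true H i j x.
Proof.
move=> gen fL fd.
have comm i j (x : E i) : cdiff E i j (f i i x) = f j j (cdiff E i j x).
  have [->|ij] := eqVneq j (i + 1); last by rewrite !cdiff_shape // glinear0.
  have := fd i (i + 1) x; rewrite /gdiff.
  by rewrite addrK => /subr0_eq.
pose g : chain_map E E :=
  @ChainMap K R E E (fun i => f i i) (fun i => fL i i) comm.
have [c [h Hh]] := gen g; exists c.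
pose u i j x := dcast j (g0 i x) : E j.
have [uL ud] := chain_gmap (erefl u).
pose G : gmap E := fun i j x => f i j x - u i j x <| c%:A.
have GL : glinear G.
  move=> i j r x y; rewrite /G fL uL ractDl scalerBr opprD addrACA.
  congr (_ - _ + _); rewrite -[r *: u i j x]/(u i j x <| r).
  exact: ract_scalarC.
have Gd i j x : gdiff false G i j x = 0.
  have := fd i j x; have := congr1 (fun y => y <| c%:A) (ud i j x).
  rewrite /gdiff /G /sgn ract0l linearB linear_ract ractDl ractNl => uE fE.
  by rewrite opprD opprK addrACA fE add0r addrC -opprB uE oppr0.
have [|H [HL HE]] := @homotopy_assemble K R E false G.
  move=> p ep; have [->|p0] := eqVneq p 0; last first.
    by rewrite -ep; apply: (exceptional_shift excE) => //; rewrite ep.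
  (* In degree 0 the target is [E (j + 0)], so the homotopy has to be transported from [E j]. *)
  exists (fun i j => @dcast _ E j (j + 0) \o h i j) => i x.
  have E0 : G i i x = cdiff E (i - 1) i (h i (i - 1) x)
      + h (i + 1) i (cdiff E i (i + 1) x).
    by rewrite -Hh /G /u dcast_id.
  rewrite /sgn /=.
  have mv i' l' (y : E (i - 1)) : i' = i -> l' = i - 1 ->
      cdiff E l' i' (dcast l' y) = dcast i' (cdiff E (i - 1) i y).
    by move=> -> ->; rewrite !dcast_id.
  rewrite (mv _ _ _ (addr0 _) (addr0 _)) -linearD -E0.
  have mvG j : j = i -> G i j x = dcast j (G i i x).
    by move=> ->; rewrite dcast_id.
  exact: mvG (addr0 i).
exists H; split=> // i j x ij; rewrite -(HE i j x ij) /G /u.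
by rewrite addrC subrK.
Qed.

(** The coordinate differentials form a two-periodic complex to which [periodic_complex_dim]
    applies, with the class of [g0] as generator of its homology. *)
Lemma exceptional_card : #|gpart b false| = #|gpart b true|.+1.
Proof.
have [g0 [nnull gen]] := exceptional_generator excE.
pose u i j x := dcast j (g0 i x) : E j.
have [uL ud] := chain_gmap (erefl u).
pose Sp e : vectType K := {ffun gpart b e -> K^o}.
pose A : {linear Sp false -> Sp true} := @gdiff_coord _ _ _ _ _ b false.
pose A' : {linear Sp true -> Sp false} := @gdiff_coord _ _ _ _ _ b true.
rewrite -!(dim_ffun K).
have embA (x : Sp false) i j z :
    gemb true (A x) i j z = gdiff false (gemb false x) i j z.
  exact: (@gemb_gdiff_coord _ _ _ _ _ b false).
have embA' (x : Sp true) i j z :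
    gemb false (A' x) i j z = gdiff true (gemb true x) i j z.
  exact: (@gemb_gdiff_coord _ _ _ _ _ b true).
have gdiff_eq e f f' :
    (forall i j x, intodd i (+) intodd j = e -> f i j x = f' i j x) ->
    gco b (~~ e) (gdiff e f) = gco b (~~ e) (gdiff e f').
  move=> ff; apply: gco_eq => i j x ij; rewrite /gdiff !ff //.
    by rewrite intoddD -addbA [_ (+) intodd j]addbC addbA ij addbT negbK.
  by rewrite intoddD addbA ij addbT negbK.
have co0 e f : (forall i j x, f i j x = 0) -> gco b e f = 0.
  move=> f0; apply/ffunP => k; rewrite !ffunE /gcoord f0.
  by rewrite cc0 linear0.
have emb0 e i j z : gemb (b := b) e 0 i j z = 0.
  by rewrite /gemb big1 // => k _; rewrite ffunE scale0r ract0.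
apply: (@periodic_complex_dim K (Sp false) (Sp true) A A' (gco b false u)).
- exact: (@gdiff_coordK _ _ _ _ _ b false).
(* Exactness in odd parity: an odd degree is never 0, so every component of a cocycle is
   null-homotopic. *)
- move=> y A'y.
  have [p podd|H [HL HE]] := @homotopy_assemble K R E true (gemb true y).
    have p0 : p != 0 by apply/eqP => p0; rewrite p0 in podd.
    have [|h Hh] := exceptional_shift excE p0 (gemb_linear y).
      by move=> i j z; rewrite podd -embA' A'y emb0.
    by exists h => i x; rewrite Hh podd.
  exists (gco b false H); rewrite -[LHS]gco_gemb.
  rewrite (gco_eq b HE) /A /= /gdiff_coord.
  apply: (gdiff_eq false) => i j x ij.
  by rewrite gemb_gco // ij.
- exact: (@gdiff_coordK _ _ _ _ _ b true).
- move=> x Ax.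
  have [|c [H [HL HE]]] := closed_even_homotopic gen (gemb_linear (b := b) x).
    by move=> i j z; rewrite -embA Ax emb0.
  exists c, (gco b true H); rewrite -[LHS]gco_gemb (gco_eq b HE) gco_linear.
  congr (_ + _); apply: (gdiff_eq true) => i j z ij.
  by rewrite gemb_gco // ij.
- rewrite -(co0 true (gdiff false u)) //; apply: (gdiff_eq false) => i j z ij.
  by rewrite gemb_gco // ij.
(* Were [u] a boundary, the degree -1 components of the odd map [y] would contract [g0]. *)
- move=> y A'y; apply: nnull.
  pose h i j : {linear E i -> E j} := HB.pack (gemb true y i j)
    (GRing.isLinear.Build R^c (E i) (E j) _ _
      (@gemb_linear _ _ _ _ _ b true y i j)).
  exists h => i x.
  have := embA' y i i x; rewrite A'y gemb_gco // addbb eqxx /u dcast_id => ->.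
  by rewrite /gdiff /sgn opprK.
Qed.
End EulerCharacteristic.

(** The value [x v] counts the summands at [v] with the sign of their degree, so the double sum
    counts matrix units with the sign of their parity: even minus odd, which is 1. *)
Lemma exceptional_euler_form (K : fieldType) (R : algType K) (T : finType)
    (B : basic_algebra R T) (E : perf R) : exceptional E ->
  exists x : T -> int, \sum_v \sum_w #|ind B v w|%:Z * x v * x w = 1 :> int.
Proof.
move=> excE; have [b _] := perf_basis B E.
pose sg s : int := (-1) ^+ intodd (@cb_deg _ _ _ _ _ b s).
pose vx := @cb_vertex _ _ _ _ _ b.
exists (fun v => \sum_(s | vx s == v) sg s).
have card e : #|gpart b e|%:Z = \sum_(k : gindex b | gparity k == e) 1.
  by rewrite card_sig sumr_const natz.
have Ek : \sum_(k : gindex b) (-1) ^+ gparity k = 1 :> int.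
  rewrite (bigID (fun k => gparity k == false)) /=.
  rewrite (eq_bigr (fun=> 1)) => [|k /eqP -> //]; rewrite -card.
  rewrite (eq_bigr (fun=> -1)) => [|k]; last by case: gparity.
  rewrite sumrN (eq_bigl (fun k => gparity k == true)) => [|k]; last first.
    by case: gparity.
  by rewrite -card (exceptional_card b excE) -addn1 PoszD addrC addKr.
pose N (v w : T) : int := #|ind B v w|%:Z.
transitivity (\sum_t \sum_s N (vx t) (vx s) * sg t * sg s).
  rewrite [RHS](partition_big vx xpredT) //=; apply: eq_bigr => v _.
  rewrite [RHS]exchange_big /= [RHS](partition_big vx xpredT) //=.
  apply: eq_bigr => w _; rewrite mulr_sumr; apply: eq_bigr => s /eqP <-.
  by rewrite mulr_sumr mulr_suml; apply: eq_bigr => t /eqP <-.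
rewrite -Ek pair_bigA /=.
transitivity (\sum_(p : cb_index b * cb_index b)
  \sum_(z : ind B (vx p.1) (vx p.2)) sg p.1 * sg p.2).
  apply: eq_bigr => p _; rewrite sumr_const -mulrA mulrC.
  by rewrite /N -natz mulr_natr.
rewrite sig_big_dep; apply: eq_bigr => -[[t s] z] _.
by rewrite /gparity /sg /= signr_addb mulrC.
Qed.

(** * Comparison of the Euler form with the value 1 *)

Local Open Scope classical_set_scope.

Theorem corollary5p4 (K : fieldType) (m n k : nat)
    (V W : 'I_m -> {vspace 'rV[K]_n})
    (K_infinite : infinite_set [set: K])
    (m_ge1 : (1 <= m)%N) (k_ge1 : (1 <= k)%N) (k_lt_n : (k < n)%N)
    (dimV : forall i, \dim (V i) = k)
    (codimW : forall i, codimv (W i) = k)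
    (smooth : finite_global_dimension (RF V W)) :
  ~ exists E : perf (RF V W), exceptional E.
Proof.
case=> E excE; pose l := (n - k)%N.
(* Coordinates on the quotients of C by [V i], of dimension [l], and then by [W i], of dimension
   [k]. *)
have quoV i : exists pi : 'M[K]_(n, l) * 'M[K]_(l, n),
    [/\ pi.2 *m pi.1 = 1%:M, forall c, c - c *m pi.1 *m pi.2 \in V i
      & forall c, c \in V i -> c *m pi.1 = 0].
  have [|pi [sec H]] := @quotient_coordinates K n l (V i).
    by rewrite dimV subnKC // ltnW.
  by exists (pi, sec).
have quoW i : exists pi : 'M[K]_(n, k) * 'M[K]_(k, n),
    [/\ pi.2 *m pi.1 = 1%:M, forall c, c - c *m pi.1 *m pi.2 \in W i
      & forall c, c \in W i -> c *m pi.1 = 0].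
  have [|pi [sec H]] := @quotient_coordinates K n k (W i).
    by have := codimW i; rewrite /codimv dimvf /dim /= mul1n; lia.
  by exists (pi, sec).
have [p Hp] := choice quoV; have [q Hq] := choice quoW.
pose B := @RF_basic K n m V W k l (fun i => (q i).1) (fun i => (q i).2)
  (fun i => (p i).1) (fun i => (p i).2)
  (fun i => let: And3 H _ _ := Hq i in H)
  (fun i => let: And3 _ H _ := Hq i in H)
  (fun i => let: And3 _ _ H := Hq i in H)
  (fun i => let: And3 H _ _ := Hp i in H)
  (fun i => let: And3 _ H _ := Hp i in H)
  (fun i => let: And3 _ _ H := Hp i in H).
have [x Ex] := exceptional_euler_form B excE.
have {Ex} : \sum_v \sum_w #|RF_index n m k l v w|%:Z * x v * x w = 1 := Ex.
rewrite !big_bool /= !card_option !card_sum !card_prod !card_ord.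
(* Vertex 1 is [false], so [x false] carries the coefficient [1 + m * l]; it remains to substitute
   [n = k + l]. *)
apply/eqP; have := @euler_form_neq1 m k l m_ge1 k_ge1 _ (x false) (x true).
rewrite subn_gt0 => /(_ k_lt_n); congr (_ != _).
have -> : n = (k + l)%N by rewrite subnKC // ltnW.
rewrite -!(addn1 (_ * _)) !(PoszD, PoszM); ring.
Qed.
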